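(* Let $S$ be a closed connected orientable hyperbolic surface endowed with a Riemannian metric and let $f\colon S\to S$ be a homeomorphism isotopic to the identity. If $z\in\mathcal{C}(f)$, then for any neighborhood $U$ of $z$ there exists $r>0$ such that $$\{\Phi_f^n(x):x\in S\}\subset B_r(\{\Phi_f^n(y):y\in U\})$$ for all $n\in\mathbb{N}$. In particular, $\rho_{\mathrm{mz}}(f,U)=\rho_{\mathrm{mz}}(f)$.
   Context: An open set $V\subset S$ is inessential if every loop in $V$ is homotopic to a point in $S$; an arbitrary set is inessential if it has an inessential open neighborhood; a set is fully essential if its complement is inessential. $\mathcal{C}(f)$ is the set of $x\in S$ such that $\bigcup_{n\in\mathbb{Z}}f^n(V)$ is fully essential for every neighborhood $V$ of $x$. Let $(f_t)_{t\in[0,1]}$ be an isotopy from the identity to $f$. Fix $b\in S$ and a family of rectifiable arcs $\gamma_x$, $x\in S$, joining $b$ to $x$, with uniformly bounded lengths. Let $\mathcal{I}_x$ be the arc $t\mapsto f_t(x)$, $\mathcal{I}^n_x=\mathcal{I}_x*\mathcal{I}_{f(x)}*\cdots*\mathcal{I}_{f^{n-1}(x)}$, and $\Phi^n_f(x)=[\gamma_x*\mathcal{I}^n_x*\gamma_{f^n(x)}^{-1}]\in H_1(S,\mathbb{Z})\subset H_1(S,\mathbb{R})$. For $E\subset S$, $\rho_{\mathrm{mz}}(f,E)$ is the set of all limits $\lim_{k\to\infty}\Phi^{n_k}_f(x_k)/n_k$ with $x_k\in E$ and $n_k\to\infty$, and $\rho_{\mathrm{mz}}(f)=\rho_{\mathrm{mz}}(f,S)$.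 $H_1(S,\mathbb{R})$ is endowed with the stable norm $\|\cdot\|$ of the Riemannian metric: for an integer class $h$, $\|h\|=\lim_{n\to\infty}\ell(nh)/n$, where $\ell(nh)$ is the infimum of lengths of closed curves representing $nh$, extended to a norm on $H_1(S,\mathbb{R})$; it satisfies $\|[\gamma]\|\le\mathrm{length}(\gamma)$ for rectifiable loops $\gamma$. For $E\subset H_1(S,\mathbb{R})$, $B_r(E)=\bigcup_{v\in E}\{w:\|v-w\|<r\}$. *)

(* Defs.v *)
From HB Require Import structures.
From mathcomp Require Import all_boot all_order all_algebra.
From mathcomp Require Import generic_quotient ring_quotient.
From mathcomp Require Import all_classical all_reals all_analysis.
From mathcomp Require Import freeg.
From mathcomp Require Import lra.

Set Implicit Arguments.
Unset Strict Implicit.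
Unset Printing Implicit Defensive.

Import Order.TTheory GRing.Theory Num.Theory.
Import numFieldNormedType.Exports.

Local Open Scope classical_set_scope.
Local Open Scope ring_scope.

Lemma within_comp (T U V : topologicalType) (A : set T) (B : set U)
    (h : T -> U) (p : U -> V) :
  {within A, continuous h} -> h @` A `<=` B -> {within B, continuous p} ->
  {within A, continuous (p \o h)}.
Proof.
move=> /subspace_continuousP ch hAB /subspace_continuousP cp.
apply/subspace_continuousP => x Ax.
have Bhx : B (h x) by apply: hAB; exists x.
move=> W /(cp _ Bhx) /(ch _ Ax); rewrite /= !nbhs_simpl /within /=.
rewrite /nbhs /=; apply: filterS => t + At; apply => //.
by apply: hAB; exists t.
Qed.

(* Two curves that agree on [0, 1] define the same simplex (simplex_of_curve),
   hence the same homology class. *)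
Record curve (R : realType) (S : topologicalType) (x y : S) := Curve {
  curve_fun :> R -> S;
  curve_cont : {within `[0, 1], continuous curve_fun};
  curve_src : curve_fun 0 = x;
  curve_tgt : curve_fun 1 = y }.

Arguments curve_cont {R S x y} c.

Section CurveOperations.
Context {R : realType} {S : topologicalType}.
Implicit Types x y z : S.

Lemma const_cont x : {within `[0, 1], continuous (cst x : R -> S)}.
Proof. by apply: continuous_subspaceT => t; exact: cvg_cst. Qed.

Definition const_curve x : curve R x x :=
  Curve (@const_cont x) erefl erefl.

Definition rev_fun (p : R -> S) : R -> S := fun t => p (1 - t).

Lemma rev_cont (p : R -> S) : {within `[0, 1], continuous p} ->
  {within `[0, 1], continuous (rev_fun p)}.
Proof.
apply: (@within_comp _ _ _ _ _ (fun t : R => 1 - t)).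
  apply: continuous_subspaceT => t.
  by apply: cvgB; [exact: cvg_cst|exact: cvg_id].
by move=> _ [t /= + <-]; rewrite !in_itv /=; lra.
Qed.

Lemma rev_src x y (p : curve R x y) : rev_fun p 0 = y.
Proof. by rewrite /rev_fun subr0 curve_tgt. Qed.

Lemma rev_tgt x y (p : curve R x y) : rev_fun p 1 = x.
Proof. by rewrite /rev_fun subrr curve_src. Qed.

Definition rev_curve x y (p : curve R x y) : curve R y x :=
  Curve (rev_cont (curve_cont p)) (rev_src p) (rev_tgt p).

Definition cat_fun (p q : R -> S) : R -> S :=
  fun t => if t <= 2^-1 then p (2 * t) else q (2 * t - 1).

Lemma cat_cont (p q : R -> S) : p 1 = q 0 ->
  {within `[0, 1], continuous p} -> {within `[0, 1], continuous q} ->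
  {within `[0, 1], continuous (cat_fun p q)}.
Proof.
move=> pq cp cq.
have -> : `[0, 1]%classic = `[0, 2^-1]%classic `|` `[2^-1, 1]%classic :> set R.
  apply/seteqP; split => t /=; rewrite !in_itv /=.
    by move=> /andP[t0 t1]; case: (leP t 2^-1) => h; [left|right]; lra.
  by case; lra.
apply: withinU_continuous; try exact: interval_closed.
  apply: (@subspace_eq_continuous _ _ _ (p \o (fun t => 2 * t))).
    by move=> t; rewrite inE /= in_itv /= => /andP[_ h]; rewrite /from_subspace /cat_fun h.
  apply: within_comp cp.
    apply: continuous_subspaceT => t.
    by apply: cvgM; [exact: cvg_cst|exact: cvg_id].
  by move=> _ [t /= + <-]; rewrite !in_itv /=; lra.
apply: (@subspace_eq_continuous _ _ _ (q \o (fun t => 2 * t - 1))).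
  move=> t; rewrite inE /= in_itv /= => /andP[h _]; rewrite /from_subspace /cat_fun /=.
  case: ifP => // h'; have -> : t = 2^-1 by lra.
  by rewrite mulfV ?pnatr_eq0 // subrr pq.
apply: within_comp cq.
  apply: continuous_subspaceT => t; apply: cvgB; last exact: cvg_cst.
  by apply: cvgM; [exact: cvg_cst|exact: cvg_id].
by move=> _ [t /= + <-]; rewrite !in_itv /=; lra.
Qed.

Lemma cat_src x y z (p : curve R x y) (q : curve R y z) : cat_fun p q 0 = x.
Proof. by rewrite /cat_fun ifT ?mulr0 ?curve_src //; lra. Qed.

Lemma cat_tgt x y z (p : curve R x y) (q : curve R y z) : cat_fun p q 1 = z.
Proof.
rewrite /cat_fun ifF; last by apply/negbTE; lra.
by rewrite -[RHS](curve_tgt q); congr (q _); lra.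
Qed.

Definition cat_curve x y z (p : curve R x y) (q : curve R y z) : curve R x z :=
  Curve (cat_cont (etrans (curve_tgt p) (esym (curve_src q)))
                  (curve_cont p) (curve_cont q))
        (cat_src p q) (cat_tgt p q).

End CurveOperations.

Section SingularChains.
Context (R : realType) (S : topologicalType).

Definition simplex (n : nat) : set 'rV[R]_n.+1 :=
  [set x | (forall i, 0 <= x 0 i) /\ \sum_i x 0 i = 1].

Arguments simplex n : clear implicits.

(* Barycentric coordinates: the i-th face is opposite to the i-th vertex. *)
Definition face_mx n (i : 'I_n.+2) (x : 'rV[R]_n.+1) : 'rV[R]_n.+2 :=
  \row_j (if unlift i j is Some k then x 0 k else 0).

Lemma face_mx_simplex n i (x : simplex n) : face_mx i (val x) \in simplex n.+1.
Proof.
case: x => x /= /set_mem[x0 x1]; apply/mem_set; split => [j|].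
  by rewrite mxE; case: unlift.
rewrite (bigD1_ord i) //= mxE unlift_none add0r -[RHS]x1.
by apply: eq_bigr => j _; rewrite mxE liftK.
Qed.

Definition face n (i : 'I_n.+2) (x : simplex n) : simplex n.+1 :=
  exist _ (face_mx i (val x)) (face_mx_simplex i x).

Lemma face_cont n (i : 'I_n.+2) : continuous (@face n i).
Proof.
have cf : continuous (@face_mx n i).
  move=> x W [M nM MW]; rewrite nbhs_simpl /=.
  have H (j : 'I_n.+2) : nbhs x [set y | M 0 j (face_mx i y 0 j)].
    move: (nM 0 j); rewrite mxE.
    case E: (unlift i j) => [k|] nk.
      have : nbhs x [set y : 'rV_n.+1 | M 0 j (y 0 k)].
        exact: (@coord_continuous R 1 n.+1 0 k x _ nk).
      by apply: filterS => y /=; rewrite mxE E.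
    have M0 := nbhs_singleton nk.
    by apply: (@filterE _ (nbhs x)) => y; rewrite /= mxE E.
  have := @filter_forall _ _ (fun j y => M 0 j (face_mx i y 0 j)) _ (nbhs_filter x) H.
  by apply: filterS => y My; apply: MW => a j; rewrite (ord1 a).
apply: continuous_comp_initial => x.
apply: (@continuous_comp _ _ _ (set_val : simplex n -> _) (@face_mx n i)).
  exact: initial_continuous.
exact: cf.
Qed.

HB.instance Definition _ n i := isContinuous.Build _ _ (@face n i) (@face_cont n i).

Definition chain (n : nat) : lmodType R :=
  {freeg (continuousType (simplex n) S) / R}.

Definition boundary n : chain n.+1 -> chain n :=
  fglift (fun s : continuousType (simplex n.+1) S =>
    \sum_(i < n.+2) (-1) ^+ i *: (<< (s \o face i : continuousType _ _) >> : chain n)).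

Lemma boundary_is_linear n : linear (@boundary n).
Proof.
have bB (a b : chain n.+1) : boundary (a - b) = boundary a - boundary b.
  exact: lift_is_additive.
have b0 : boundary (0 : chain n.+1) = 0.
  by rewrite -(subrr (0 : chain n.+1)) bB subrr.
have U k (x : continuousType (simplex n.+1) S) : boundary << k *g x >> = k *: boundary << x >>.
  by rewrite /boundary !liftU scale1r.
move=> k u v.
have bN (a : chain n.+1) : boundary (- a) = - boundary a by rewrite -[- a]sub0r bB b0 sub0r.
have bD (a b : chain n.+1) : boundary (a + b) = boundary a + boundary b.
  by have := bB a (- b); rewrite bN !opprK.
rewrite bD; congr (_ + _).
have bs (I : Type) (r : seq I) (F : I -> chain n.+1) :
    boundary (\sum_(i <- r) F i) = \sum_(i <- r) boundary (F i).
  exact: big_morph.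
rewrite -[u in LHS]freeg_sumE -[u in RHS]freeg_sumE scaler_sumr !bs scaler_sumr.
apply: eq_bigr => x _; rewrite [in RHS]U scalerA -U; congr boundary.
by apply/eqP/freeg_eqP => y; rewrite coeffZ !coeffU mulrA.
Qed.

HB.instance Definition _ n :=
  GRing.isLinear.Build R (chain n.+1) (chain n) *:%R (@boundary n)
    (@boundary_is_linear n).

Definition cycle_pred : {pred chain 1} := fun c => boundary c == 0.

Lemma cycle_submod_closed : submod_closed cycle_pred.
Proof.
split=> [|k u v]; rewrite !unfold_in ?linear0 //.
by move=> /eqP u0 /eqP v0; rewrite linearP /= u0 v0 scaler0 addr0.
Qed.

HB.instance Definition _ :=
  GRing.isSubmodClosed.Build R (chain 1) cycle_pred cycle_submod_closed.

Record cycle := Cycle { cycle_val :> chain 1; cycle_valP : cycle_val \in cycle_pred }.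

HB.instance Definition _ := [isSub for cycle_val].
HB.instance Definition _ := [Choice of cycle by <:].
HB.instance Definition _ := [SubChoice_isSubLmodule of cycle by <:].

Definition boundary_pred : {pred cycle} :=
  fun c => `[< exists d : chain 2, boundary d = c >].

Lemma boundary_zmod_closed : zmod_closed boundary_pred.
Proof.
split=> [|u v]; rewrite !unfold_in.
  by apply/asboolP; exists 0; rewrite linear0.
move=> /asboolP[d du] /asboolP[e ev]; apply/asboolP; exists (d - e).
by rewrite linearB /= du ev.
Qed.

HB.instance Definition _ :=
  GRing.isZmodClosed.Build cycle boundary_pred boundary_zmod_closed.

Definition H1 := {ideal_quot boundary_pred}.
HB.instance Definition _ := GRing.Zmodule.on H1.
HB.instance Definition _ := EqQuotient.on H1.

Definition H1_class : cycle -> H1 := \pi_H1%qT.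

Definition H1_scale (k : R) (h : H1) : H1 := H1_class (k *: repr h).

Lemma H1_classD (u v : cycle) : H1_class (u + v) = H1_class u + H1_class v.
Proof. by rewrite /H1_class; unlock; rewrite !piE. Qed.

Lemma H1_class_eq (u v : cycle) :
  H1_class u = H1_class v <-> exists d : chain 2, boundary d = u - v :> chain 1.
Proof.
split=> [/eqP|[d duv]].
  by rewrite /H1_class piE /Quotient.equiv unfold_in => /asboolP.
by apply/eqP; rewrite /H1_class piE /Quotient.equiv unfold_in; apply/asboolP; exists d.
Qed.

Lemma H1_classZ k (u : cycle) : H1_class (k *: u) = H1_scale k (H1_class u).
Proof.
have [d du] : exists d : chain 2, boundary d = u - repr (H1_class u) :> chain 1.
  by apply/H1_class_eq; rewrite /H1_class reprK.
by apply/H1_class_eq; exists (k *: d); rewrite linearZ /= du scalerBr.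
Qed.

Lemma H1_classK h : H1_class (repr h) = h.
Proof. exact: reprK. Qed.

Lemma H1_scaleA a b h : H1_scale a (H1_scale b h) = H1_scale (a * b) h.
Proof. by rewrite -[h]H1_classK -!H1_classZ scalerA. Qed.

Lemma H1_scale1 : left_id 1 H1_scale.
Proof. by move=> h; rewrite -[h]H1_classK -H1_classZ scale1r. Qed.

Lemma H1_scaleDr : right_distributive H1_scale +%R.
Proof.
by move=> a g h; rewrite -[g]H1_classK -[h]H1_classK -H1_classD -!H1_classZ scalerDr H1_classD.
Qed.

Lemma H1_scaleDl h : {morph H1_scale^~ h : a b / a + b}.
Proof. by move=> a b; rewrite -[h]H1_classK -!H1_classZ scalerDl H1_classD. Qed.

HB.instance Definition _ := GRing.Zmodule_isLmodule.Build R H1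
  H1_scaleA H1_scale1 H1_scaleDr H1_scaleDl.

(* The image of H_1(S, Z) in H_1(S, R). *)
Definition integral_class (h : H1) :=
  exists c : cycle, (forall s, coeff s (c : chain 1) \is a Num.int) /\ H1_class c = h.

End SingularChains.

Arguments simplex R n : clear implicits.
Arguments H1 R S : clear implicits.
Arguments chain R S n : clear implicits.

Section LoopClass.
Context {R : realType} {S : topologicalType}.

(* The parameter of the curve is the barycentric coordinate at the vertex 1. *)
Definition simplex_of_fun (p : R -> S) : simplex R 1 -> S :=
  fun u => p ((val u : 'rV[R]_2) 0 1).

Lemma simplex_of_fun_cont (p : R -> S) : {within `[0, 1], continuous p} ->
  continuous (simplex_of_fun p).
Proof.
move=> cp; apply/continuous_subspace_setT.
have hc : continuous (fun u : simplex R 1 => (set_val u : 'rV[R]_2) 0 1).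
  move=> u; apply: (@continuous_comp _ _ _ (set_val : simplex R 1 -> _)
    (fun v : 'rV[R]_2 => v 0 1)).
    exact: initial_continuous.
  exact: coord_continuous.
apply: (within_comp _ _ cp); first by apply: continuous_subspaceT; exact: hc.
move=> _ [[u /= /set_mem[u0 u1]] _ <-] /=; rewrite in_itv /= u0 -u1.
by rewrite (bigD1 1) //= lerDl sumr_ge0.
Qed.

Definition simplex_of_curve x y (p : curve R x y) : continuousType (simplex R 1) S :=
  mkcts (simplex_of_fun_cont (curve_cont p)).

Lemma loop_cycle x (p : curve R x x) :
  (<< simplex_of_curve p >> : chain R S 1) \in @cycle_pred R S.
Proof.
rewrite unfold_in /boundary liftU scale1r !big_ord_recl big_ord0 addr0.
rewrite /= expr0 expr1 scale1r scaleN1r subr_eq0; apply/eqP.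
congr (<< _ >>); apply/continuousEP => u.
have [_] := set_mem (valP u); rewrite big_ord1 => u1.
rewrite /= /mkcts /simplex_of_fun /= /face_mx !mxE.
have -> : fintype.lift ord0 ord0 = 1 :> 'I_2 by apply/val_inj.
rewrite unlift_none; case: unliftP => [k _|/(congr1 val)//].
by rewrite (ord1 k) -[sval u]/(val u) u1 curve_src curve_tgt.
Qed.

Definition loop_class x (p : curve R x x) : H1 R S :=
  H1_class (Cycle (loop_cycle p)).

End LoopClass.

Section Surfaces.
Context {R : realType} {S : topologicalType}.

Record chart := Chart {
  chart_dom : set S;
  chart_fun : S -> 'rV[R]_2;
  chart_inv : 'rV[R]_2 -> S }.

Definition chart_im (c : chart) : set 'rV[R]_2 := chart_fun c @` chart_dom c.

Definition is_chart (c : chart) :=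
  [/\ open (chart_dom c), open (chart_im c),
      {within chart_dom c, continuous (chart_fun c)},
      {within chart_im c, continuous (chart_inv c)} &
      {in chart_dom c, cancel (chart_fun c) (chart_inv c)}].

Definition overlap (c c' : chart) : set 'rV[R]_2 :=
  chart_fun c @` (chart_dom c `&` chart_dom c').

Definition transition (c c' : chart) : 'rV[R]_2 -> 'rV[R]_2 :=
  chart_fun c' \o chart_inv c.

(* On an open set W this is C^oo: every iterated directional derivative of f
   is differentiable at every point of W. *)
Definition smooth_on (V : normedModType R) (W : set 'rV[R]_2) (f : 'rV[R]_2 -> V) :=
  forall (vs : seq 'rV[R]_2) x, W x ->
    differentiable (foldr (fun v (h : 'rV[R]_2 -> V) y => 'D_v h y) f vs) x.

Definition smooth_atlas (A : set chart) :=
  [/\ forall c, A c -> is_chart c,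
      forall x, exists c, A c /\ chart_dom c x &
      forall c c', A c -> A c' -> smooth_on (overlap c c') (transition c c')].

Definition oriented (A : set chart) :=
  forall c c' x, A c -> A c' -> overlap c c' x -> 0 < \det ('J (transition c c') x).

(* [g c x] is the Gram matrix of the metric at the point of coordinates x in
   the chart c. Tangent vectors are rows, on which 'J acts from the right. *)
Definition riemannian_metric (A : set chart) (g : chart -> 'rV[R]_2 -> 'M[R]_2) :=
  [/\ forall c i j, A c -> smooth_on (chart_im c) (fun x => g c x i j),
      forall c x, A c -> chart_im c x -> (g c x)^T = g c x,
      forall c x (v : 'rV[R]_2), A c -> chart_im c x -> v != 0 ->
        0 < (v *m g c x *m v^T) 0 0 &
      forall c c' x, A c -> A c' -> overlap c c' x ->
        g c x = 'J (transition c c') x *m g c' (transition c c' x)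
                *m ('J (transition c c') x)^T].

Definition half_plane_metric (x : 'rV[R]_2) : 'M[R]_2 := ((x 0 1) ^- 2)%:M.

(* S carries some metric of constant curvature -1: an atlas of local isometries
   into the upper half-plane. *)
Definition hyperbolic_surface :=
  exists A : set chart, [/\ smooth_atlas A,
    forall c x, A c -> chart_im c x -> 0 < x 0 1 &
    riemannian_metric A (fun=> half_plane_metric)].

Definition orientable_surface := exists A : set chart, smooth_atlas A /\ oriented A.

Definition closed_connected_space :=
  [/\ compact [set: S], hausdorff_space S & connected [set: S]].

Section Lengths.
Variables (A : set chart) (g : chart -> 'rV[R]_2 -> 'M[R]_2).

Definition C1_arc (c : chart) (u : R -> 'rV[R]_2) :=
  [/\ forall t, 0 <= t <= 1 -> chart_im c (u t) /\ derivable u t 1 &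
      {within `[0, 1], continuous (fun t => 'D_1 u t)}].

Definition C1_length (c : chart) (u : R -> 'rV[R]_2) : R :=
  \int[lebesgue_measure]_(t in `[0, 1])
     Num.sqrt (('D_1 u t *m g c (u t) *m ('D_1 u t)^T) 0 0).

(* [piecewise_C1 x y L]: there is a piecewise C^1 curve of length L from x to y;
   it is cut into arcs each contained in a chart domain. *)
Inductive piecewise_C1 : S -> S -> R -> Prop :=
| piecewise_nil x : piecewise_C1 x x 0
| piecewise_cons c u y L : A c -> C1_arc c u ->
    piecewise_C1 (chart_inv c (u 1)) y L ->
    piecewise_C1 (chart_inv c (u 0)) y (C1_length c u + L).

Definition riemannian_dist (x y : S) : R := inf [set L | piecewise_C1 x y L].

Definition curve_length x y (p : curve R x y) : \bar R :=
  ereal_sup [set l | exists (n : nat) (t : nat -> R),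
    [/\ {homo t : i j / (i <= j)%N >-> i <= j}, forall i, 0 <= t i <= 1 &
        l = (\sum_(i < n) riemannian_dist (p (t i)) (p (t i.+1)))%:E]].

(* The equation with L%:E restricts to rectifiable closed curves. *)
Definition min_length (h : H1 R S) : R :=
  inf [set L : R | exists x (p : curve R x x),
    loop_class p = h /\ curve_length p = L%:E].

(* The last clause determines N: integral classes span H1 over R. For a closed
   orientable surface H_1(S, Z) is torsion free, so that representing n h in
   H_1(S, R) or in H_1(S, Z) is the same. *)
Record is_stable_norm (N : H1 R S -> R) : Prop := IsStableNorm {
  stable_normD : forall u v, N (u + v) <= N u + N v;
  stable_normZ : forall a u, N (a *: u) = `|a| * N u;
  stable_norm0_eq0 : forall u, N u = 0 -> u = 0;
  stable_norm_integral : forall h, integral_class h ->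
    (fun n => min_length (h *+ n) / n%:R) @ \oo --> N h }.

End Lengths.
End Surfaces.

Arguments chart R S : clear implicits.
Arguments hyperbolic_surface R S : clear implicits.
Arguments orientable_surface R S : clear implicits.
Arguments closed_connected_space S : clear implicits.

Section EssentialDynamics.
Context (R : realType) {S : topologicalType}.

Definition null_homotopic (p : R -> S) :=
  exists (H : R * R -> S) (c : S),
    {within `[0, 1] `*` `[0, 1], continuous H} /\
    forall t, 0 <= t <= 1 -> [/\ H (0, t) = p t, H (1, t) = c & H (t, 0) = H (t, 1)].

Definition inessential_open (V : set S) :=
  open V /\ forall x (p : curve R x x),
    (forall t, 0 <= t <= 1 -> V (p t)) -> null_homotopic p.

Definition inessential (E : set S) :=
  exists V, inessential_open V /\ E `<=` V.

Definition fully_essential (E : set S) := inessential (~` E).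

Definition homeomorphism (f : S -> S) :=
  continuous f /\ exists g, [/\ cancel f g, cancel g f & continuous g].

(* The image of V by f^k, for f bijective. *)
Definition iterz_image (f : S -> S) (k : int) (V : set S) : set S :=
  match k with
  | Posz n => iter n f @` V
  | Negz n => iter n.+1 f @^-1` V
  end.

Definition essential_points (f : S -> S) : set S :=
  [set x | forall V, nbhs x V ->
     fully_essential (\bigcup_(k in [set: int]) iterz_image f k V)].

End EssentialDynamics.

Section Rotation.
Context {R : realType} {S : topologicalType}.

Record isotopy_from_id (f : S -> S) := IsotopyFromId {
  isotopy_fun :> R -> S -> S;
  isotopy_cont : {within `[0, 1] `*` [set: S],
    continuous (fun tx : R * S => isotopy_fun tx.1 tx.2)};
  isotopy_homeo : forall t, 0 <= t <= 1 -> homeomorphism (isotopy_fun t);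
  isotopy0 : forall x, isotopy_fun 0 x = x;
  isotopy1 : forall x, isotopy_fun 1 x = f x }.

Lemma trace_cont f (F : isotopy_from_id f) x :
  {within `[0, 1], continuous (F^~ x)}.
Proof.
apply: (within_comp _ _ (@isotopy_cont f F) (h := fun t : R => (t, x))).
  apply: continuous_subspaceT => t.
  move=> W [[U V] /= [nU /nbhs_singleton Vx] UVW].
  by move: nU; apply: filterS => s Us; apply: UVW.
by move=> _ [t t01 <-].
Qed.

Definition trace f (F : isotopy_from_id f) x : curve R x (f x) :=
  Curve (@trace_cont f F x) (isotopy0 F x) (isotopy1 F x).

(* The initial constant curve does not change the homotopy class. *)
Fixpoint iter_trace f (F : isotopy_from_id f) n x : curve R x (iter n f x) :=
  match n return curve R x (iter n f x) with
  | 0 => const_curve x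
  | n'.+1 => cat_curve (iter_trace F n' x) (trace F (iter n' f x))
  end.

Variables (f : S -> S) (F : isotopy_from_id f).
Variables (b : S) (gamma : forall x, curve R b x).

Definition displacement n x : H1 R S :=
  loop_class (cat_curve (cat_curve (gamma x) (iter_trace F n x))
                        (rev_curve (gamma (iter n f x)))).

Variable N : H1 R S -> R.

Definition norm_nbhd (r : R) (E : set (H1 R S)) : set (H1 R S) :=
  \bigcup_(v in E) [set w | N (v - w) < r].

(* H1 is finite-dimensional, so that its topology is that of the norm N. *)
Definition rotation_set (E : set S) : set (H1 R S) :=
  [set v | exists (n_ : nat -> nat) (x_ : nat -> S),
    [/\ forall k, E (x_ k), n_ @ \oo --> \oo &
        (fun k => N ((n_ k)%:R^-1 *: displacement (n_ k) (x_ k) - v)) @ \oo --> (0 : R)]].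

End Rotation.

(* Main.v *)
Require Import Defs.
From HB Require Import structures.
From mathcomp Require Import all_boot all_order all_algebra.
From mathcomp Require Import all_classical all_reals all_analysis.
From mathcomp Require Import freeg.
From mathcomp Require Import lra.
Import Order.TTheory GRing.Theory Num.Theory.
Import numFieldNormedType.Exports.
Set Implicit Arguments.
Unset Strict Implicit.
Unset Printing Implicit Defensive.
Local Open Scope classical_set_scope.
Local Open Scope ring_scope.

(** Close every arc p from x to y into the loop gamma_x * p * gamma_y^-1 and call
    its homology class the class of p. Classes are additive under concatenation
    and invariant under homotopies that fix the endpoints, and Phi^n(x) is the
    class of the trace I^n_x. If p joins x to y, the isotopy gives a homotopy
    between p * I^n_y and I^n_x * f^n(p), hence

      Phi^n(x) - Phi^n(y) = [p] - [f^n(p)]          ([displacement_push]).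

    Two points therefore have displacements that stay close for all times as soon
    as, for each n, some arc between them has a bounded class and a bounded image
    under f^n.

    Let O be the union of the images of the interior of U. Its complement lies in
    an open set V in which every loop is homotopic to a point in S, and by
    normality it lies in an open set V' whose closure is contained in V. A point
    outside V' is on the orbit of a point of U, at a distance in time that is
    bounded by compactness, which changes Phi^n by a bounded amount
    ([saturation_bounded]).

    Now let x be in V'. Unless H_1 receives only zero from loops (and then all
    displacements vanish) there is a homologically nontrivial loop l. Start at
    f^n(x) and follow an arc q that goes to the base point and then around l.
    Since f^n(V) is as inessential as V, q cannot stay in f^n(V'); let y be the
    image under f^-n of the point at which q first leaves f^n(V'). The part of
    q before that point has a bounded class, because q may be chosen from a
    family that is controlled by compactness ([escape_path]). Its image p under
    f^-n runs in the closure of V', and arcs in V with endpoints in that compact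
    set have bounded classes because in V the class depends on the endpoints only
    ([inessential_bounded]). So Phi^n(x) is close to Phi^n(y) with y outside V'
    ([displacement_escape]).

    All bounds reduce to one local fact ([small_cell]): every point has
    arbitrarily small neighborhoods, cells, in which arcs have bounded classes.
    In a chart ball an arc is homotopic to a concatenation of two straight
    segments through the center, and the stable norm of a rectifiable loop is at
    most its length ([stable_norm_loop]).

    The equality of the rotation sets follows on dividing by n. *)

(** * Topological preliminaries *)

Lemma continuous_pair (T U V : topologicalType) (f : T -> U) (g : T -> V) :
  continuous f -> continuous g -> continuous (fun t => (f t, g t)).
Proof.
move=> cf cg t.
exact: (@cvg_pair _ _ _ (nbhs t) (nbhs (f t)) (nbhs (g t)) _ _ _ f g (cf t) (cg t)).
Qed.

Section RealContinuity.
Context {R : realType} {T : topologicalType}.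
Implicit Types f g : T -> R.

Lemma continuous_add f g :
  continuous f -> continuous g -> continuous (fun t => f t + g t).
Proof. by move=> cf cg t; exact: (cvgD (cf t) (cg t)). Qed.

Lemma continuous_sub f g :
  continuous f -> continuous g -> continuous (fun t => f t - g t).
Proof. by move=> cf cg t; exact: (cvgB (cf t) (cg t)). Qed.

Lemma continuous_mul f g :
  continuous f -> continuous g -> continuous (fun t => f t * g t).
Proof. by move=> cf cg t; exact: (cvgM (cf t) (cg t)). Qed.

End RealContinuity.

Lemma continuous_fst (T U : topologicalType) : continuous (@fst T U).
Proof. by move=> t; exact: cvg_fst. Qed.

Lemma continuous_snd (T U : topologicalType) : continuous (@snd T U).
Proof. by move=> t; exact: cvg_snd. Qed.

Ltac continuous_arith := repeat lazymatch goal with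
  | |- continuous (fun t => (@?f t, @?g t)) => apply: (@continuous_pair _ _ _ f g)
  | |- continuous (fun t => @?f t - @?g t) => apply: (@continuous_sub _ _ f g)
  | |- continuous (fun t => @?f t + @?g t) => apply: (@continuous_add _ _ f g)
  | |- continuous (fun t => @?f t * @?g t) => apply: (@continuous_mul _ _ f g)
  | |- continuous (fun t => t) => by move=> ?; exact: cvg_id
  | |- continuous (fun t => fst t) => exact: continuous_fst
  | |- continuous (fun t => snd t) => exact: continuous_snd
  | |- continuous (fun t => ?c) => by move=> ?; exact: cvg_cst
  end.

Lemma zero_in01 (R : numDomainType) : 0 <= (0 : R) <= 1.
Proof. by rewrite lexx ler01. Qed.

Lemma one_in01 (R : numDomainType) : 0 <= (1 : R) <= 1.
Proof. by rewrite lexx ler01. Qed.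

Lemma itv01_segment (R : realFieldType) (a c t : R) :
  0 <= a <= 1 -> 0 <= c <= 1 -> 0 <= t <= 1 -> 0 <= a + t * (c - a) <= 1.
Proof. nra. Qed.

(** A property that spreads locally in both directions spreads over a connected
    set: where it holds and where it fails are both relatively open. *)
Lemma connected_propagation (T : topologicalType) (K E : set T) (x : T) :
  connected K ->
  (forall y, K y -> exists2 W, nbhs y W &
     forall u v, W u -> K u -> W v -> K v -> E u -> E v) ->
  K x -> E x -> K `<=` E.
Proof.
move=> conK loc Kx Ex; suff <- : K `&` E = K by move=> y [].
apply: conK; first by exists x.
- exists ([set y | K y -> E y]°); first exact: open_interior.
  apply/seteqP; split=> [y [Ky Ey]|y [Ky /interior_subset/(_ Ky)]//].
  split=> //; have [W nW WE] := loc y Ky; apply: filterS (nW) => v Wv Kv.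
  exact: (WE y v (nbhs_singleton nW)).
exists (~` ([set y | K y -> ~ E y]°)); first exact/open_closedC/open_interior.
apply/seteqP; split=> [y [Ky Ey]|y [Ky nEy]]; split=> //.
  by move=> /interior_subset/(_ Ky).
apply: contrapT => Ey; apply: nEy; have [W nW WE] := loc y Ky.
apply: filterS (nW) => v Wv Kv Ev; apply: Ey.
exact: (WE v y Wv Kv (nbhs_singleton nW)).
Qed.

(** The form in which compactness is used: local bounds C give a global one. *)
Lemma compact_bounded (R : realType) (T : topologicalType) (K : set T)
    (Q : R -> T -> Prop) : compact K ->
  (forall C C' x, C <= C' -> Q C x -> Q C' x) ->
  (forall x, K x -> exists C, \forall y \near x, Q C y) ->
  exists C, forall x, K x -> Q C x.
Proof.
move=> /compact_near_coveringP cK mono loc.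
have [C [_ hC]] : \forall C \near +oo, K `<=` Q C.
  apply: cK => x Kx; have [C nC] := loc x Kx.
  exists ([set y | Q C y], [set C' | C < C']); first by split=> //; exists C; split=> //; exact: num_real.
  by move=> [y C'] /= [QCy /ltW CC']; exact: mono QCy.
by exists (C + 1) => x Kx; apply: hC => //; rewrite ltrDl.
Qed.

Lemma first_exit (R : realType) (S : topologicalType) (G : R -> S) (V : set S) :
  {within `[0, 1], continuous G} -> open V -> V (G 0) ->
  (exists2 t, 0 <= t <= 1 & ~ V (G t)) ->
  exists2 T, 0 <= T <= 1 &
    [/\ ~ V (G T), closure V (G T) & forall t, 0 <= t < T -> V (G t)].
Proof.
move=> /subspace_continuousP cG oV V0 [t0 t01 Vt0].
pose E := [set t | 0 <= t <= 1 /\ ~ V (G t)].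
have hE : has_inf E.
  by split; [exists t0|exists 0 => t [/andP[]]].
have infE t : E t -> inf E <= t by move=> Et; apply: ge_inf => //; case: hE.
have T0 : 0 <= inf E by apply: lb_le_inf; [exists t0|move=> t [/andP[]]].
have T1 : inf E <= 1.
  by apply: (@le_trans _ _ t0); [exact: infE|lra].
have T01 : 0 <= inf E <= 1 by rewrite T0.
have bef t : 0 <= t < inf E -> V (G t).
  move=> /andP[t_0 tT]; apply: contrapT => Vt.
  suff : inf E <= t by lra.
  by apply: infE; split=> //; lra.
have nearW W : nbhs (G (inf E)) W -> exists2 e, 0 < e &
    forall t, 0 <= t <= 1 -> `|inf E - t| < e -> W (G t).
  move=> nW; have := cG (inf E); rewrite /= in_itv /= => /(_ T01 _ nW).
  rewrite nbhs_simpl /= => /nbhs_normP[e /= e0 he]; exists e => // t t_01 te.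
  by apply: (he t te); rewrite /= in_itv.
have nV : ~ V (G (inf E)).
  move=> VT; have [e e0 he] := nearW V (open_nbhs_nbhs (conj oV VT)).
  have [t Et tT] := inf_adherent e0 hE; have := infE t Et.
  have [t_01 Vt] := Et => infEt; apply: Vt; apply: he => //.
  by rewrite distrC ger0_norm; lra.
exists (inf E) => //; split=> // W nW; have [e e0 he] := nearW _ nW.
have Tpos : 0 < inf E.
  by rewrite lt_neqAle T0 andbT; apply/eqP => T_0; apply: nV; rewrite -T_0.
pose t := Num.max 0 (inf E - e / 2).
have tT : 0 <= t < inf E by rewrite /t /Num.max; case: ifP; lra.
exists (G t); split; first exact: bef.
apply: he; first lra.
by rewrite ger0_norm; rewrite /t /Num.max; case: ifP; lra.
Qed.

(** * Homeomorphisms and inessential sets *)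

Section Homeo.
Context {R : realType} {S : topologicalType}.

Lemma homeomorphism_iter (f : S -> S) n : homeomorphism f -> homeomorphism (iter n f).
Proof.
move=> [cf [h [fK hK ch]]].
have citer (k : S -> S) m : continuous k -> continuous (iter m k).
  move=> ck; elim: m => [|m IH] x; first exact: cvg_id.
  exact: (@continuous_comp _ _ _ (iter m k) k x (IH x) (ck _)).
split; first exact: citer.
exists (iter n h); split; last exact: citer.
- by move=> x; elim: n x => // n IH x; rewrite iterSr iterS fK IH.
- by move=> x; elim: n x => // n IH x; rewrite iterSr iterS hK IH.
Qed.

(** A loop is sent by h into V and is contracted in S, and f brings the contraction
    back. *)
Lemma inessential_open_preimage (f h : S -> S) (V : set S) :
  continuous f -> continuous h -> cancel h f ->
  @inessential_open R S V -> @inessential_open R S (h @^-1` V).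
Proof.
move=> cf ch hK [oV Vnull]; split; first by move/continuousP: ch; apply.
move=> x p pV.
have chp : {within `[0, 1], continuous (h \o p)}.
  apply: (@within_comp _ _ _ _ setT p h); first exact: curve_cont.
    by [].
  exact: continuous_subspaceT.
have hp0 : (h \o p) 0 = h x by rewrite /= curve_src.
have hp1 : (h \o p) 1 = h x by rewrite /= curve_tgt.
have [H [c [cH Hp]]] := Vnull _ (Curve chp hp0 hp1) pV.
exists (f \o H), (f c); split.
  apply: (@within_comp _ _ _ _ setT H f) => //.
  exact: continuous_subspaceT.
by move=> t /Hp[/= -> -> ->]; rewrite hK.
Qed.

End Homeo.

(** * Relative homology classes of arcs *)

Section Homology.
Context {R : realType} {S : topologicalType}.
Implicit Types x y z : S.

Definition curve_chain x y (p : curve R x y) : chain R S 1 :=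
  << simplex_of_curve p >>.

Definition homologous (c d : chain R S 1) :=
  exists e : chain R S 2, boundary e = c - d.

(** The one source of boundaries: G restricted to the triangle 0 <= t <= s <= 1 is
    a singular 2-simplex, with vertices (0, 0), (1, 0), (1, 1). Additivity,
    homotopy invariance and the behaviour under reversal are instances. *)
Lemma homologous_triangle x y z (p : curve R x y) (q : curve R y z)
    (r : curve R x z) (G : R * R -> S) :
  {within [set st | 0 <= st.2 <= st.1 /\ st.1 <= 1], continuous G} ->
  (forall t, 0 <= t <= 1 -> [/\ p t = G (t, 0), q t = G (1, t) & r t = G (t, t)]) ->
  homologous (curve_chain p + curve_chain q) (curve_chain r).
Proof.
move=> cG Gpqr.
pose T (u : simplex R 2) : S :=
  (* s and t are the sums of the barycentric coordinates from 1 and from 2 on. *)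
  G ((val u : 'rV[R]_3) 0 1 + (val u : 'rV[R]_3) 0 2%:R, (val u : 'rV[R]_3) 0 2%:R).
have cT : continuous T.
  apply/continuous_subspace_setT; apply: (within_comp _ _ cG
   (h := fun u : simplex R 2 => ((val u : 'rV[R]_3) 0 1 + (val u : 'rV[R]_3) 0 2%:R,
                                 (val u : 'rV[R]_3) 0 2%:R))).
    have hc i : continuous (fun u : simplex R 2 => (set_val u : 'rV[R]_3) 0 i).
      move=> u; apply: (@continuous_comp _ _ _ (set_val : simplex R 2 -> _)
        (fun v : 'rV[R]_3 => v 0 i)).
        exact: initial_continuous.
      exact: coord_continuous.
    apply: continuous_subspaceT; apply: continuous_pair; last exact: hc.
    by move=> u; exact: (cvgD (hc 1 u) (hc 2%:R u)).
  move=> _ [[u /= /set_mem[u0 u1]] _ <-] /=.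
  move: u1; rewrite !big_ord_recl big_ord0 addr0 => u1.
  have := u0 ord0; have := u0 1; have := u0 2%:R.
  have e1 : fintype.lift ord0 ord0 = 1 :> 'I_3 by apply/val_inj.
  have e2 : fintype.lift ord0 (fintype.lift ord0 ord0) = 2%:R :> 'I_3 by apply/val_inj.
  rewrite e1 e2 in u1.
  lra.
exists << (mkcts cT : continuousType _ _) >>.
rewrite /boundary liftU scale1r !big_ord_recl big_ord0 addr0.
rewrite /= expr0 expr1 expr2 mulN1r opprK !scale1r scaleN1r.
have E x0 y0 (a : curve R x0 y0) i :
    (forall u : simplex R 1, T (face i u) = a ((val u : 'rV[R]_2) 0 1)) ->
   << (mkcts cT \o face i : continuousType _ _) >> = curve_chain a.
  move=> H; congr (<< _ >>); apply/continuousEP => u; rewrite /= /mkcts /simplex_of_fun /=.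
  exact: H.
have F0 i (u : simplex R 1) : (val (face i u) : 'rV[R]_3) 0 i = 0.
  by rewrite /= mxE unlift_none.
have FS i k (u : simplex R 1) :
    (val (face i u) : 'rV[R]_3) 0 (fintype.lift i k) = (val u : 'rV[R]_2) 0 k.
  by rewrite /= mxE liftK.
have u01 (u : simplex R 1) : (val u : 'rV[R]_2) 0 0 = 1 - (val u : 'rV[R]_2) 0 1 /\
    0 <= (val u : 'rV[R]_2) 0 1 <= 1.
  have [u0] := set_mem (valP u); rewrite !big_ord_recl big_ord0 addr0.
  rewrite (_ : fintype.lift ord0 ord0 = 1 :> 'I_2); last by apply/val_inj.
  rewrite (_ : ord0 = 0 :> 'I_2); last by apply/val_inj.
  by have := u0 0; have := u0 1; set a := _ 0 0; set c := _ 0 1; lra.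
have ord_lift n (i : 'I_n.+1) (k : 'I_n) (j : 'I_n.+1) : bump i k = j ->
  j = fintype.lift i k by move=> h; apply/val_inj.
rewrite (E _ _ q) ?(E _ _ r (fintype.lift ord0 ord0))
  ?(E _ _ p (fintype.lift ord0 (fintype.lift ord0 ord0))); first last.
- move=> u; have [e /Gpqr[_ -> _]] := u01 u; rewrite /T.
  have := FS ord0 0 u; rewrite -(ord_lift 2 ord0 0 1) // => ->.
  have := FS ord0 1 u; rewrite -(ord_lift 2 ord0 1 2%:R) // => ->; rewrite e.
  by congr (G (_, _)); lra.
- move=> u; have [e /Gpqr[_ _ ->]] := u01 u; rewrite /T.
  rewrite -(ord_lift 2 ord0 ord0 1) // F0.
  have := FS 1 1 u; rewrite -(ord_lift 2 1 1 2%:R) // => ->.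
  by congr (G (_, _)); lra.
- move=> u; have [e /Gpqr[-> _ _]] := u01 u; rewrite /T.
  rewrite -(ord_lift 1%N ord0 ord0 1) // -(ord_lift 2 ord0 1 2%:R) // F0.
  have := FS 2%:R 1 u; rewrite -(ord_lift 2 2%:R 1 1) // => ->.
  by congr (G (_, _)); lra.
by rewrite addrA addrAC (addrC (curve_chain q)).
Qed.

Definition point_chain x : chain R S 0 :=
  << (mkcts (@cst_continuous (simplex R 0) S x) : continuousType _ _) >>.

Lemma boundary_curve_chain x y (p : curve R x y) :
  boundary (curve_chain p) = point_chain y - point_chain x.
Proof.
rewrite /boundary liftU scale1r !big_ord_recl big_ord0 addr0.
rewrite /= expr0 expr1 scale1r scaleN1r.
congr (<< _ >> - << _ >>); apply/continuousEP => u;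
  have [_] := set_mem (valP u); rewrite big_ord1 => u1;
  rewrite /= /mkcts /simplex_of_fun /= /face_mx !mxE.
  have -> : 1 = fintype.lift ord0 ord0 :> 'I_2 by apply/val_inj.
  by rewrite liftK -[sval u]/(val u) u1 curve_tgt.
have -> : fintype.lift ord0 ord0 = 1 :> 'I_2 by apply/val_inj.
by rewrite unlift_none curve_src.
Qed.

Variables (b : S) (gamma : forall x, curve R b x).

Lemma closed_arc_cycle x y (p : curve R x y) :
  curve_chain (gamma x) + curve_chain p - curve_chain (gamma y) \in @cycle_pred R S.
Proof.
rewrite unfold_in linearB linearD /= !boundary_curve_chain.
by rewrite [X in X - _]addrC addrA subrK subrr.
Qed.

(** The class of the loop gamma_x * p * gamma_y^-1, as a sum of chains rather than
    as a concatenation, so that the auxiliary arcs cancel algebraically. *)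
Definition arc_class x y (p : curve R x y) : H1 R S :=
  H1_class (Cycle (closed_arc_cycle p)).

Lemma arc_class_triangle x y z (p : curve R x y) (q : curve R y z)
    (r : curve R x z) :
  homologous (curve_chain p + curve_chain q) (curve_chain r) ->
  arc_class p + arc_class q = arc_class r.
Proof.
move=> [e ee]; rewrite /arc_class -H1_classD; apply/H1_class_eq; exists e.
rewrite ee /=.
set A := curve_chain (gamma x); set B := curve_chain (gamma y).
set C := curve_chain (gamma z).
have -> : A + curve_chain p - B + (B + curve_chain q - C) =
    A - C + (curve_chain p + curve_chain q).
  by rewrite [RHS]addrAC -!addrA addKr.
by rewrite [A + _ - C]addrAC opprD addrACA subrr add0r.
Qed.

Lemma arc_class_loop x (p : curve R x x) : arc_class p = loop_class p.
Proof.
apply/H1_class_eq; exists 0.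
by rewrite linear0 /= addrAC addrK subrr.
Qed.

(** The value is independent of x, so it cancels in differences. *)
Lemma arc_class_gamma x : arc_class (gamma x) = loop_class (gamma b).
Proof.
apply/H1_class_eq; exists 0.
by rewrite linear0 /= addrK subrr.
Qed.

Lemma arc_class_eq x y x' y' (p : curve R x y) (q : curve R x' y') :
  (forall t, 0 <= t <= 1 -> p t = q t) -> arc_class p = arc_class q.
Proof.
move=> pq.
have ex : x = x' by rewrite -(curve_src p) -(curve_src q) pq // lexx ler01.
have ey : y = y' by rewrite -(curve_tgt p) -(curve_tgt q) pq // lexx ler01.
case: _ / ex q pq => q pq; case: _ / ey q pq => q pq.
apply/H1_class_eq; exists 0.
rewrite linear0 /= (_ : curve_chain p = curve_chain q) ?subrr//.
congr (<< _ >>); apply/continuousEP => u; rewrite /= /mkcts /simplex_of_fun; apply: pq.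
have [u0] := set_mem (valP u); rewrite !big_ord_recl big_ord0 addr0.
rewrite (_ : fintype.lift ord0 ord0 = 1 :> 'I_2); last by apply/val_inj.
rewrite (_ : ord0 = 0 :> 'I_2); last by apply/val_inj.
by have := u0 0; have := u0 1; set a := _ 0 0; set c := _ 0 1; lra.
Qed.

(** The triangle (0, 0), (1, 0), (1, 1) is projected on its long edge by
    (s + t) / 2; the two other edges are the two halves of the concatenation. *)
Lemma arc_class_cat x y z (p : curve R x y) (q : curve R y z) :
  arc_class (cat_curve p q) = arc_class p + arc_class q.
Proof.
symmetry; apply: arc_class_triangle.
apply: (homologous_triangle
  (G := cat_curve p q \o (fun st : R * R => 2^-1 * (st.1 + st.2)))).
  apply: within_comp (curve_cont (cat_curve p q)).
    by apply: continuous_subspaceT; continuous_arith.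
  by move=> _ [[s t] /= ? <-] /=; rewrite in_itv /=; lra.
move=> t t01; rewrite /= /cat_fun; split.
- by rewrite ifT; [congr (p _); lra|lra].
- case: ifP => [h|_]; last by congr (q _); lra.
  have -> : t = 0 by lra.
  rewrite curve_src -[LHS](curve_tgt p); congr (p _); lra.
- by rewrite (_ : 2^-1 * (t + t) = t) //; lra.
Qed.

(** A constant arc equals its own square under concatenation. *)
Lemma arc_class_cst x y (p : curve R x y) c :
  (forall t, 0 <= t <= 1 -> p t = c) -> arc_class p = 0.
Proof.
move=> pc; rewrite (@arc_class_eq _ _ _ _ p (const_curve c)) //.
apply: (@addrI _ (arc_class (const_curve c))).
rewrite addr0 -arc_class_cat; apply: arc_class_eq => t _.
by rewrite /= /cat_fun; case: ifP.
Qed.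

Lemma arc_class_rev x y (p : curve R x y) : arc_class (rev_curve p) = - arc_class p.
Proof.
apply/eqP; rewrite -addr_eq0 addrC; apply/eqP.
rewrite -(@arc_class_cst _ _ (const_curve x) x) //.
apply: arc_class_triangle.
apply: (homologous_triangle (G := p \o (fun st : R * R => st.1 - st.2))).
  apply: within_comp (curve_cont p).
    by apply: continuous_subspaceT; continuous_arith.
  by move=> _ [[s t] /= ? <-] /=; rewrite in_itv /=; lra.
by move=> t t01; rewrite /= /rev_fun subr0 subrr curve_src.
Qed.

(** The diagonal cuts the square in two singular triangles. *)
Lemma arc_class_square x y w z (bot : curve R x y) (right : curve R y z)
    (left : curve R x w) (top : curve R w z) (H : R * R -> S) :
  {within `[0, 1] `*` `[0, 1], continuous H} ->
  (forall t, 0 <= t <= 1 -> [/\ bot t = H (t, 0), right t = H (1, t),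
                               left t = H (0, t) & top t = H (t, 1)]) ->
  arc_class bot + arc_class right = arc_class left + arc_class top.
Proof.
move=> cH Hsides.
have cdiag : {within `[0, 1], continuous (H \o (fun t : R => (t, t)))}.
  apply: within_comp cH.
    by apply: continuous_subspaceT; continuous_arith.
  by move=> _ [t /= ? <-].
have h0 := zero_in01 R.
have h1 := one_in01 R.
have d0 : (H \o (fun t : R => (t, t))) 0 = x.
  by rewrite /=; have [<- _ _ _] := Hsides 0 h0; rewrite curve_src.
have d1 : (H \o (fun t : R => (t, t))) 1 = z.
  by rewrite /=; have [_ _ _ <-] := Hsides 1 h1; rewrite curve_tgt.
transitivity (arc_class (Curve cdiag d0 d1)).
  apply/arc_class_triangle/(homologous_triangle (G := H)).
    by apply: continuous_subspaceW cH => -[s t] /=; rewrite !in_itv /=; lra.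
  by move=> t /Hsides[].
symmetry; apply/arc_class_triangle.
apply: (homologous_triangle (G := H \o (fun st : R * R => (st.2, st.1)))).
  apply: within_comp cH.
    apply: continuous_subspaceT.
    by continuous_arith.
  by move=> _ [[s t] /= ? <-] /=; rewrite !in_itv /=; lra.
by move=> t /Hsides[].
Qed.

(** In a free null homotopy the two sides traced by the base point are equal, so
    they cancel in the relation of the square. *)
Lemma arc_class_null x (p : curve R x x) : null_homotopic p -> arc_class p = 0.
Proof.
move=> [H [c [cH Hp]]].
have cedge e : 0 <= e <= 1 -> {within `[0, 1], continuous (fun t : R => H (t, e))}.
  move=> e01; apply: (@within_comp _ _ _ _ _ (fun t : R => (t, e)) H _ _ cH).
    by apply: continuous_subspaceT; continuous_arith.
  by move=> _ [t /= ? <-]; rewrite /= !in_itv /=.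
have h0 := zero_in01 R.
have h1 := one_in01 R.
have [H00 H10 _] := Hp 0 h0; have [H01 H11 _] := Hp 1 h1.
rewrite curve_src in H00; rewrite curve_tgt in H01.
pose bot := Curve (cedge 0 h0) H00 H10; pose top := Curve (cedge 1 h1) H01 H11.
have : arc_class bot + arc_class (const_curve c) = arc_class p + arc_class top.
  by apply: (arc_class_square cH) => t /Hp[].
rewrite (@arc_class_cst _ _ (const_curve c) c) // addr0.
rewrite (@arc_class_eq _ _ _ _ bot top); last by move=> t /Hp[].
by move/eqP; rewrite -subr_eq subrr => /eqP <-.
Qed.

Section Subarc.
Variables (P : R -> S) (cP : {within `[0, 1], continuous P}).

Lemma subarc_cont a c : 0 <= a <= 1 -> 0 <= c <= 1 ->
  {within `[0, 1], continuous (P \o (fun t => a + t * (c - a)))}.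
Proof.
move=> a01 c01; apply: within_comp cP.
  by apply: continuous_subspaceT; continuous_arith.
by move=> _ [t /= + <-]; rewrite !in_itv /=; nra.
Qed.

Lemma subarc_src a c : (P \o (fun t => a + t * (c - a))) 0 = P a.
Proof. by rewrite /= mul0r addr0. Qed.

Lemma subarc_tgt a c : (P \o (fun t => a + t * (c - a))) 1 = P c.
Proof. by rewrite /= mul1r addrC subrK. Qed.

Definition subarc a c (a01 : 0 <= a <= 1) (c01 : 0 <= c <= 1) : curve R (P a) (P c) :=
  Curve (subarc_cont a01 c01) (subarc_src a c) (subarc_tgt a c).

Lemma arc_class_subarc a c e (a01 : 0 <= a <= 1) (c01 : 0 <= c <= 1) (e01 : 0 <= e <= 1) :
  arc_class (subarc a01 e01) = arc_class (subarc a01 c01) + arc_class (subarc c01 e01).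
Proof.
symmetry; apply/arc_class_triangle.
apply: (homologous_triangle
  (G := P \o (fun st : R * R => (1 - st.1) * a + (st.1 - st.2) * c + st.2 * e))).
  apply: within_comp cP.
    by apply: continuous_subspaceT; continuous_arith.
  by move=> _ [[s t] /= ? <-] /=; rewrite in_itv /=; nra.
by move=> t t01; split => /=; congr (P _); lra.
Qed.

End Subarc.
End Homology.

(** * Lengths in a Riemannian metric *)

Section Metric.
Context {R : realType} {S : topologicalType}.
Variables (A : set (chart R S)) (g : chart R S -> 'rV[R]_2 -> 'M[R]_2).

Lemma normr_mx_entry m n (M : 'M[R]_(m.+1, n.+1)) i j : `|M i j| <= `|M|.
Proof.
rewrite [leRHS]mx_normrE; exact: (le_bigmax _ (fun ij => `|M ij.1 ij.2|) (i, j)).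
Qed.

Lemma is_derive_line (u w : 'rV[R]_2) (t : R) :
  is_derive t (1 : R) (fun s : R => u + s *: w) w.
Proof.
have cvgw : h^-1 *: (((fun s : R => u + s *: w) \o shift t) (h *: 1) - (u + t *: w))
    @[h --> 0^'] --> w.
  apply: cvg_near_cst; near=> h.
  rewrite /= opprD addrACA subrr add0r -scalerBl addrK scalerA [h *: 1]mulr1 mulVf ?scale1r //.
  by near: h; exact: nbhs_dnbhs_neq.
by apply: DeriveDef; [exact: (cvgP _ cvgw)|exact: (cvg_lim _ cvgw)].
Unshelve. all: by end_near. Qed.

Lemma segment_ball (V : normedModType R) (y0 u v : V) r t : 0 <= t <= 1 ->
  `|y0 - u| < r -> `|y0 - v| < r -> `|y0 - (u + t *: (v - u))| < r.
Proof.
move=> /andP[t0 t1] ur vr.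
have -> : y0 - (u + t *: (v - u)) = (1 - t) *: (y0 - u) + t *: (y0 - v).
  rewrite scalerBl scale1r -addrA [- _ + _]addrC -scalerBr [- (y0 - u)]opprB.
  by rewrite [y0 - v + _]addrC addrA subrK opprD addrA -scalerN opprB.
apply: (le_lt_trans (ler_normD _ _)); rewrite !normrZ (ger0_norm t0) ger0_norm ?subr_ge0 //.
have [->|tn0] := eqVneq t 0; first by rewrite subr0 mul0r mul1r addr0.
have h1 : (1 - t) * `|y0 - u| <= (1 - t) * r by rewrite ler_wpM2l ?subr_ge0 // ltW.
have h2 : t * `|y0 - v| < t * r by rewrite ltr_pM2l // lt_neqAle eq_sym tn0.
by lra.
Qed.

Lemma quadratic_form_le (M : 'M[R]_2) (w : 'rV[R]_2) K : (forall i j, `|M i j| <= K) ->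
  (w *m M *m w^T) 0 0 <= 4 * K * `|w| ^+ 2.
Proof.
move=> MK.
have term i j : w 0 i * M i j * w 0 j <= K * `|w| ^+ 2.
  apply: (le_trans (ler_norm _)); rewrite !normrM expr2 mulrA.
  rewrite ler_pM ?mulr_ge0 ?normr_mx_entry // mulrC.
  by rewrite ler_pM ?normr_mx_entry.
rewrite mxE (eq_bigr (fun j => \sum_i w 0 i * M i j * w 0 j)); last first.
  by move=> j _; rewrite !mxE mulr_suml.
rewrite (le_trans (ler_sum _ (fun j _ => ler_sum _ (fun i _ => term i j)))) //.
by rewrite !sumr_const card_ord -mulrnA -[leRHS]mulrA mulr_natl.
Qed.

Lemma continuous_quadratic_form (M : R -> 'M[R]_2) (w : 'rV[R]_2) (t : R) :
  (forall i j, {for t, continuous (fun s => M s i j)}) ->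
  {for t, continuous (fun s => (w *m M s *m w^T) 0 0)}.
Proof.
move=> cM.
rewrite (_ : (fun s => _) = (fun s => \sum_j \sum_i w 0 i * M s i j * w 0 j)); last first.
  by apply/funext => s; rewrite mxE; apply: eq_bigr => j _; rewrite !mxE mulr_suml.
rewrite /continuous_at.
apply: cvg_big => [|j _]; first exact: add_continuous.
apply: cvg_big => [|i _]; first exact: add_continuous.
by apply: cvgM; [apply: cvgM; [exact: cvg_cst|exact: cM]|exact: cvg_cst].
Qed.

Lemma continuous_chart_inv (c : chart R S) y : is_chart c -> chart_im c y ->
  {for y, continuous (chart_inv c)}.
Proof.
move=> [_ oim _ cinv _] imy.
by move: cinv; rewrite continuous_open_subspace // => /(_ y); apply; rewrite inE.
Qed.

Lemma C1_length_line_le c (u w : 'rV[R]_2) K : 0 <= K ->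
  (forall t : R, 0 <= t <= 1 -> forall i j,
     `|g c (u + t *: w) i j| <= K /\ {for u + t *: w, continuous (fun y => g c y i j)}) ->
  C1_length g c (fun t => u + t *: w) <= Num.sqrt (4 * K) * `|w|.
Proof.
move=> K0 gK; rewrite /C1_length.
rewrite (_ : (fun t => _) = fun t : R => Num.sqrt ((w *m g c (u + t *: w) *m w^T) 0 0)); last first.
  by apply/funext => t; rewrite (@derive_val _ _ _ _ _ _ _ (is_derive_line u w t)).
have m01 : measurable (`[0, 1] : set R) by exact: measurable_itv.
apply: (@le_trans _ _ (\int[lebesgue_measure]_(t in `[0%R, 1%R]) (Num.sqrt (4 * K) * `|w|))).
  apply: le_Rintegral => //.
  - apply: continuous_compact_integrable; first exact: segment_compact.
    apply: continuous_in_subspaceT => t; rewrite inE /= in_itv /= => t01.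
    apply: (@continuous_comp _ _ _ _ Num.sqrt); last exact: sqrt_continuous.
    apply: continuous_quadratic_form => i j.
    apply: (@continuous_comp _ _ _ (fun s : R => u + s *: w) (fun y => g c y i j)).
      apply: cvgD; first exact: cvg_cst.
      by apply: cvgZl; exact: cvg_id.
    by have [] := gK _ t01 i j.
  - apply: continuous_compact_integrable; first exact: segment_compact.
    by apply: continuous_subspaceT => ?; exact: cvg_cst.
  move=> t; rewrite /= in_itv /= => t01.
  rewrite -[`|w|]ger0_norm // -sqrtr_sqr -sqrtrM ?mulr_ge0 //.
  rewrite ler_wsqrtr // quadratic_form_le // => i j.
  by have [] := gK _ t01 i j.
rewrite Rintegral_cst //= lebesgue_measure_itv /= lte_fin ltr01 /= oppr0 addr0 mulr1.
by [].
Qed.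

(** In a small ball of a chart the metric is bounded, so that straight segments
    bound the Riemannian distance by a multiple K of the Euclidean one. *)
Lemma chart_cell x W : smooth_atlas A -> riemannian_metric A g -> nbhs x W ->
  exists c r K, [/\ A c, chart_dom c x, 0 < r, 0 <= K &
    (forall y, `|chart_fun c x - y| < r -> chart_im c y /\ W (chart_inv c y)) /\
    forall u v, `|chart_fun c x - u| < r -> `|chart_fun c x - v| < r ->
      exists2 L, piecewise_C1 A g (chart_inv c u) (chart_inv c v) L & L <= K * `|v - u|].
Proof.
move=> [chA covA _] [smg _ _ _] nW.
have [c [Ac cx]] := covA x.
have chc := chA _ Ac; have [odom oim cfun cinv Kc] := chc.
set y0 := chart_fun c x.
have imy0 : chart_im c y0 by exists x.
have invy0 : chart_inv c y0 = x by apply: Kc; rewrite inE.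
have nim : \near y0, chart_im c y0 by exact: open_nbhs_nbhs.
have nWy : \forall y \near y0, W (chart_inv c y).
  by apply: (continuous_chart_inv chc imy0); rewrite /= invy0.
have cg i j y : chart_im c y -> {for y, continuous (fun y => g c y i j)}.
  by move=> imy; apply/differentiable_continuous/(smg c i j Ac [::] y imy).
pose M := \sum_i \sum_j (`|g c y0 i j| + 1).
have nM : \forall y \near y0, forall i j, `|g c y i j| < `|g c y0 i j| + 1.
  apply: (@filter_forall _ _ (fun i y => forall j, `|g c y i j| < `|g c y0 i j| + 1)
    _ (nbhs_filter y0)) => i.
  apply: (@filter_forall _ _ (fun j y => `|g c y i j| < `|g c y0 i j| + 1)
    _ (nbhs_filter y0)) => j.
  apply: (@cvgr_lt _ _ _ _ (fun y => `|g c y i j|) (`|g c y0 i j|)); last by rewrite ltrDl.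
  exact: (cvg_norm (cg i j y0 imy0)).
have {nM} nM : \forall y \near y0, forall i j, `|g c y i j| <= M.
  apply: filterS nM => y hy i j; apply: (le_trans (ltW (hy i j))).
  rewrite /M (bigD1 i) //= (bigD1 j) //= -addrA lerDl addr_ge0 //.
    by apply: sumr_ge0 => ? _; rewrite addr_ge0.
  by apply: sumr_ge0 => ? _; apply: sumr_ge0 => ? _; rewrite addr_ge0.
have M0 : 0 <= M by apply: sumr_ge0 => ? _; apply: sumr_ge0 => ? _; rewrite addr_ge0.
have : \forall y \near y0, [/\ chart_im c y, W (chart_inv c y) & forall i j, `|g c y i j| <= M].
  by near=> y; split; near: y.
move=> /nbhs_normP[r /= r0 hr].
exists c, r, (Num.sqrt (4 * M)); split => //.
split=> [y /hr[]//|u v ur vr].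
have seg t : 0 <= t <= 1 -> `|y0 - (u + t *: (v - u))| < r by move=> ?; exact: segment_ball.
have := @C1_length_line_le c u (v - u) M M0.
set p := fun t : R => _ => hL.
exists (C1_length g c p + 0).
  have p0 : p 0 = u by rewrite /p scale0r addr0.
  have p1 : p 1 = v by rewrite /p scale1r addrC subrK.
  have := @piecewise_cons R S A g c p (chart_inv c v) 0 Ac; rewrite p0 p1; apply.
    split=> [t t01|].
      split; first by have [] := hr _ (seg _ t01).
      by have := is_derive_line u (v - u) t => -[].
    apply: continuous_subspaceT => t.
    rewrite (_ : (fun t => _) = fun=> v - u); first exact: cvg_cst.
    by apply/funext => s; rewrite (@derive_val _ _ _ _ _ _ _ (is_derive_line u (v - u) s)).
  exact: piecewise_nil.
rewrite addr0; apply: hL => t t01 i j.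
by have [imt _ gt] := hr _ (seg _ t01); split=> //; exact: cg.
Unshelve. all: by end_near. Qed.
End Metric.

Lemma nbhs_chart_cell (R : realType) (S : topologicalType) (c : chart R S) x r :
  is_chart c -> chart_dom c x -> 0 < r ->
  nbhs x [set y | chart_dom c y /\ `|chart_fun c x - chart_fun c y| < r].
Proof.
move=> [od _ cf _ _] cx r0.
apply: filterI; first exact: open_nbhs_nbhs.
move: cf; rewrite continuous_open_subspace // => /(_ x (mem_set cx)) cf.
apply: (cf [set y | `|chart_fun c x - y| < r]).
exact: (nbhs_ball_norm _ (PosNum r0)).
Qed.

Lemma chart_invK (R : realType) (S : topologicalType) (c : chart R S) y :
  is_chart c -> chart_im c y ->
  chart_dom c (chart_inv c y) /\ chart_fun c (chart_inv c y) = y.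
Proof. by move=> [_ _ _ _ Kc] [s cs <-]; rewrite Kc ?inE. Qed.

Section Distance.
Context {R : realType} {S : topologicalType}.
Variables (A : set (chart R S)) (g : chart R S -> 'rV[R]_2 -> 'M[R]_2).
Local Notation d := (riemannian_dist A g).

Lemma piecewise_C1_ge0 x y L : piecewise_C1 A g x y L -> 0 <= L.
Proof.
elim=> // c u z {}L _ _ _ L0; apply: addr_ge0 => //.
by apply: Rintegral_ge0 => t _; exact: sqrtr_ge0.
Qed.

Lemma piecewise_C1_trans x y z L L' :
  piecewise_C1 A g x y L -> piecewise_C1 A g y z L' -> piecewise_C1 A g x z (L + L').
Proof.
elim=> [{}x|c u {}y {}L Ac cu _ IH] yz; first by rewrite add0r.
by rewrite -addrA; apply: piecewise_cons => //; exact: IH.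
Qed.

Lemma riemannian_dist_ge0 x y : 0 <= d x y.
Proof.
have [ne|] := pselect ([set L | piecewise_C1 A g x y L] !=set0).
  by apply: lb_le_inf => // L; exact: piecewise_C1_ge0.
by move=> /set0P/negP/negPn/eqP; rewrite /riemannian_dist => ->; rewrite inf0.
Qed.

Lemma riemannian_dist_le x y L : piecewise_C1 A g x y L -> d x y <= L.
Proof. by move=> xy; apply: ge_inf => //; exists 0 => M; exact: piecewise_C1_ge0. Qed.

Hypotheses (cS : connected [set: S]) (hA : smooth_atlas A) (hg : riemannian_metric A g).

(** Needed for the triangle inequality, because the infimum over an empty set of
    lengths would be 0. *)
Lemma piecewise_C1_connected x y : exists L, piecewise_C1 A g x y L.
Proof.
apply: (@connected_propagation _ setT [set y | exists L, piecewise_C1 A g x y L] x) => //.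
  move=> z _.
  have [c [r [K [Ac cz r0 _ [_ seg]]]]] := chart_cell hA hg (@filterT _ (nbhs z) _).
  have [/(_ c Ac) chc _ _] := hA; have [_ _ _ _ Kc] := chc.
  exists [set y | chart_dom c y /\ `|chart_fun c z - chart_fun c y| < r].
    exact: nbhs_chart_cell.
  move=> u v [cu ur] _ [cv vr] _ [L xu].
  have [L' + _] := seg _ _ ur vr; rewrite !Kc ?inE // => uv.
  by exists (L + L'); exact: piecewise_C1_trans xu uv.
by exists 0; exact: piecewise_nil.
Qed.

Lemma riemannian_dist_triangle y x z : d x z <= d x y + d y z.
Proof.
have [xy nexy] := piecewise_C1_connected x y.
have [yz neyz] := piecewise_C1_connected y z.
rewrite -lerBlDl; apply: lb_le_inf; first by exists yz.
move=> L' hL'; rewrite lerBlDl -lerBlDr; apply: lb_le_inf; first by exists xy.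
move=> L hL; rewrite lerBlDr; apply: riemannian_dist_le; exact: piecewise_C1_trans hL hL'.
Qed.

Lemma curve_length_leP x y (p : curve R x y) L :
  (curve_length A g p <= L%:E)%E <->
  forall n (t : nat -> R), {homo t : i j / (i <= j)%N >-> i <= j} ->
    (forall i, 0 <= t i <= 1) -> \sum_(i < n) d (p (t i)) (p (t i.+1)) <= L.
Proof.
split=> [/ereal_supP h n t ht t01|h].
  by rewrite -lee_fin; apply: h; exists n, t.
by apply/ereal_supP => _ [n [t [ht t01 ->]]]; rewrite lee_fin; exact: h.
Qed.

(** A subdivision of [0, 1] induces one of each half, by clamping the parameter.
    Clamping repeats points, at no cost, and inserts the common endpoint into the
    only interval that straddles 1/2. *)
Lemma curve_length_cat x y z (p : curve R x y) (q : curve R y z) L L' :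
  (curve_length A g p <= L%:E)%E -> (curve_length A g q <= L'%:E)%E ->
  (curve_length A g (cat_curve p q) <= (L + L')%:E)%E.
Proof.
move=> /curve_length_leP hp /curve_length_leP hq; apply/curve_length_leP => n t ht t01.
pose t1 i := Num.min (2 * t i) 1; pose t2 i := Num.max (2 * t i - 1) 0.
have h1 := hp n t1; have h2 := hq n t2.
apply: (@le_trans _ _ (\sum_(i < n) (d (p (t1 i)) (p (t1 i.+1)) +
                                     d (q (t2 i)) (q (t2 i.+1))))).
  apply: ler_sum => i _; rewrite /t1 /t2 /= /cat_fun.
  have tt : t i <= t i.+1 by apply: ht.
  have := t01 i; have := t01 i.+1; move: tt; set u := t i; set v := t i.+1 => uv v01 u01.
  case: ifPn => [u2|]; [|rewrite -ltNge => u2]; case: ifPn => [v2|]; try (rewrite -ltNge => v2).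
  - rewrite !min_l ?lerDl ?riemannian_dist_ge0 //; lra.
  - rewrite min_l ?min_r ?(@max_r _ _ (2 * u - 1)) ?(@max_l _ _ (2 * v - 1)); try lra.
    by rewrite curve_tgt curve_src; exact: riemannian_dist_triangle.
  - by exfalso; lra.
  - rewrite !max_l ?lerDr ?riemannian_dist_ge0 //; lra.
rewrite big_split lerD //; [apply: h1|apply: h2].
- move=> i j /ht tij; rewrite /t1; have := t01 i; have := t01 j.
  by rewrite /Num.min; case: ifP; case: ifP; lra.
- by move=> i; have := t01 i; rewrite /t1 /Num.min; case: ifP; lra.
- move=> i j /ht tij; rewrite /t2; have := t01 i; have := t01 j.
  by rewrite /Num.max; case: ifP; case: ifP; lra.
- by move=> i; have := t01 i; rewrite /t2 /Num.max; case: ifP; lra.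
Qed.

End Distance.

(** * The stable norm of a loop *)

Section StableNorm.
Context {R : realType} {S : topologicalType}.
Variables (A : set (chart R S)) (g : chart R S -> 'rV[R]_2 -> 'M[R]_2).

Lemma curve_length_ge0 x y (p : curve R x y) : (0 <= curve_length A g p)%E.
Proof.
apply: le_ereal_sup_tmp; exists 0%E => //.
by exists 0%N, (fun=> 0); split=> // [i|]; rewrite ?lexx ?ler01 // big_ord0.
Qed.

Lemma curve_length_const x : (curve_length A g (const_curve x) <= 0%:E)%E.
Proof.
apply/curve_length_leP => n t _ _; apply: sumr_le0 => i _ /=.
by apply: riemannian_dist_le; exact: piecewise_nil.
Qed.

Lemma cell_segment c y0 r K u v :
  is_chart c -> (forall y, `|y0 - y| < r -> chart_im c y) ->
  (forall u v, `|y0 - u| < r -> `|y0 - v| < r ->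
      exists2 L, piecewise_C1 A g (chart_inv c u) (chart_inv c v) L & L <= K * `|v - u|) ->
  `|y0 - u| < r -> `|y0 - v| < r ->
  exists p : curve R (chart_inv c u) (chart_inv c v),
    (forall t, p t = chart_inv c (u + t *: (v - u))) /\
    (curve_length A g p <= (K * `|v - u|)%:E)%E.
Proof.
move=> [_ _ _ cinv _] imc hK ur vr.
have seg t : 0 <= t <= 1 -> `|y0 - (u + t *: (v - u))| < r by move=> ?; exact: segment_ball.
pose l := fun t : R => u + t *: (v - u).
have cl : {within `[0, 1], continuous (chart_inv c \o l)}.
  apply: within_comp cinv.
    apply: continuous_subspaceT => t; apply: cvgD; first exact: cvg_cst.
    by apply: cvgZl; exact: cvg_id.
  by move=> _ [t /= + <-]; rewrite in_itv /= => /seg/imc.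
have p0 : (chart_inv c \o l) 0 = chart_inv c u by rewrite /= /l scale0r addr0.
have p1 : (chart_inv c \o l) 1 = chart_inv c v by rewrite /= /l scale1r addrC subrK.
exists (Curve cl p0 p1); split=> //; apply/curve_length_leP => n t ht t01.
apply: (@le_trans _ _ (\sum_(i < n) K * ((t i.+1 - t i) * `|v - u|))).
  apply: ler_sum => i _ /=.
  have [L pL LK] := hK _ _ (seg _ (t01 i)) (seg _ (t01 i.+1)).
  apply: (le_trans (riemannian_dist_le pL)); apply: (le_trans LK).
  rewrite opprD addrACA subrr add0r -scalerBl normrZ ger0_norm //.
  by rewrite subr_ge0 ht.
rewrite -mulr_sumr -mulr_suml.
have K0 : 0 <= K * `|v - u|.
  by have [L /piecewise_C1_ge0 L0 /(le_trans L0)] := hK _ _ ur vr.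
have -> : \sum_(i < n) (t i.+1 - t i) = t n - t 0%N.
  by rewrite -(big_mkord xpredT (fun i => t i.+1 - t i)) telescope_sumr.
have := t01 n; have := t01 0%N; nra.
Qed.

Variables (b : S) (gamma : forall x, curve R b x).
Hypotheses (cS : connected [set: S]) (hA : smooth_atlas A) (hg : riemannian_metric A g).

Lemma loop_power x (p : curve R x x) L n : (curve_length A g p <= L%:E)%E ->
  exists q : curve R x x, loop_class q = loop_class p *+ n /\
    (curve_length A g q <= (n%:R * L)%:E)%E.
Proof.
move=> pL; elim: n => [|n [q [qp qL]]].
  exists (const_curve x); rewrite mulr0n mul0r -(arc_class_loop gamma).
  by split; [exact: (@arc_class_cst _ _ _ gamma _ _ _ x)|exact: curve_length_const].
exists (cat_curve p q); rewrite -(arc_class_loop gamma) arc_class_cat !arc_class_loop qp mulrS.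
by split=> //; rewrite mulrS mulrDl mul1r; exact: curve_length_cat.
Qed.

Lemma min_length_le h L : (exists x (p : curve R x x), loop_class p = h /\
    (curve_length A g p <= L%:E)%E) -> min_length A g h <= L.
Proof.
move=> [x [p [ph pL]]].
have fin : curve_length A g p = (fine (curve_length A g p))%:E.
  rewrite fineK // ge0_fin_numE ?curve_length_ge0 //.
  by apply: (le_lt_trans pL); rewrite ltry.
apply: (@le_trans _ _ (fine (curve_length A g p))); last by rewrite -lee_fin -fin.
apply: ge_inf; last by exists x, p.
by exists 0 => M [y [q [_ qM]]]; rewrite -lee_fin -qM curve_length_ge0.
Qed.

Lemma integral_class_loop x (p : curve R x x) : @integral_class R S (loop_class p).
Proof.
exists (Cycle (loop_cycle p)); split=> // s /=.
by rewrite coeffU mul1r; case: (_ == _); rewrite ?rpred1 ?rpred0.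
Qed.

Variables (N : H1 R S -> R) (hN : is_stable_norm A g N).

(** The class of the n-th power of the loop p is n [p], so the minimal length of
    n [p] is at most n times the length of p. *)
Lemma stable_norm_loop x (p : curve R x x) L : (curve_length A g p <= L%:E)%E ->
  N (loop_class p) <= L.
Proof.
move=> pL; have cvN := stable_norm_integral hN (integral_class_loop p).
rewrite -(cvg_lim _ cvN) //.
apply: limr_le; first exact: cvgP cvN.
near=> n; have n0 : 0 < n%:R :> R by rewrite ltr0n; near: n; exists 1%N.
rewrite ler_pdivrMr // mulrC; apply: min_length_le.
by have [q ?] := loop_power n pL; exists x, q.
Unshelve. all: by end_near. Qed.

Lemma stable_norm0 : N 0 = 0.
Proof. by rewrite -(scale0r 0) (stable_normZ hN) normr0 mul0r. Qed.

Lemma stable_normN u : N (- u) = N u.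
Proof. by rewrite -scaleN1r (stable_normZ hN) normrN1 mul1r. Qed.

Lemma stable_norm_ge0 u : 0 <= N u.
Proof. by have := stable_normD hN u (- u); rewrite subrr stable_norm0 stable_normN; lra. Qed.

Lemma stable_normB u v : N (u - v) <= N u + N v.
Proof. by rewrite -(stable_normN v); exact: stable_normD hN _ _. Qed.

End StableNorm.

(** * Uniform bounds on classes of arcs *)

Section Displacement.
Context {R : realType} {S : topologicalType}.
Variables (A : set (chart R S)) (g : chart R S -> 'rV[R]_2 -> 'M[R]_2).
Variables (b : S) (gamma : forall x, curve R b x).
Hypotheses (cS : connected [set: S]) (hA : smooth_atlas A) (hg : riemannian_metric A g).

Local Notation "[ 'arc' p ]" := (arc_class gamma p) (at level 0, format "[ 'arc'  p ]").

(** Closing a loop by such an arc avoids reversing gamma, that is, comparing the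
    lengths of a curve and its reverse. *)
Lemma rectifiable_arc x : exists L (p : curve R x b), (curve_length A g p <= L%:E)%E.
Proof.
apply: (@connected_propagation _ setT
  [set x | exists L (p : curve R x b), (curve_length A g p <= L%:E)%E] b) => //.
  move=> z _.
  have [c [r [K [Ac cz r0 _ [rim seg]]]]] := chart_cell hA hg (@filterT _ (nbhs z) _).
  have [/(_ c Ac) chc _ _] := hA; have [_ _ _ _ Kc] := chc.
  exists [set y | chart_dom c y /\ `|chart_fun c z - chart_fun c y| < r].
    exact: nbhs_chart_cell.
  move=> u v [cu ur] _ [cv vr] _ [L [p pL]].
  have [|s [_ sL]] := cell_segment chc _ seg vr ur; first by move=> y /rim[].
  move: s sL; rewrite !Kc ?inE // => s sL.
  by exists (K * `|chart_fun c u - chart_fun c v| + L), (cat_curve s p); exact: curve_length_cat.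
by exists 0, (const_curve b); exact: curve_length_const.
Qed.

(** The straight-line homotopy in the chart. *)
Lemma arc_class_cell (c : chart R S) y0 r u v (p q : curve R u v) :
  is_chart c -> (forall y, `|y0 - y| < r -> chart_im c y) ->
  (forall t, 0 <= t <= 1 -> chart_dom c (p t) /\ `|y0 - chart_fun c (p t)| < r) ->
  (forall t, 0 <= t <= 1 -> chart_dom c (q t) /\ `|y0 - chart_fun c (q t)| < r) ->
  arc_class gamma p = arc_class gamma q.
Proof.
move=> [_ _ cfun cinv Kc] rim pr qr.
pose h (st : R * R) := chart_fun c (p st.2) + st.1 *: (chart_fun c (q st.2) - chart_fun c (p st.2)).
have cpath (a : curve R u v) :
    (forall t, 0 <= t <= 1 -> chart_dom c (a t) /\ `|y0 - chart_fun c (a t)| < r) ->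
    {within `[0, 1] `*` `[0, 1], continuous (fun st : R * R => chart_fun c (a st.2))}.
  move=> ar.
  apply: (@within_comp _ _ _ _ _ (fun st : R * R => a st.2) (chart_fun c) _ _ cfun).
    apply: (@within_comp _ _ _ _ _ (fun st : R * R => st.2) a _ _ (curve_cont a)).
      by apply: continuous_subspaceT; exact: continuous_snd.
    by move=> _ [[s t] /= [_ t01] <-].
  by move=> _ [[s t] /= [_ t01] <-]; rewrite in_itv /= in t01; have [] := ar t t01.
have ch : {within `[0, 1] `*` `[0, 1], continuous h}.
  move=> st; apply: cvgD; first exact: cpath.
  apply: cvgZ; last by apply: cvgB; exact: cpath.
  by apply: (continuous_subspaceT (f := fun st : R * R => st.1)); exact: continuous_fst.
have cH : {within `[0, 1] `*` `[0, 1], continuous (chart_inv c \o h)}.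
  apply: within_comp cinv => //.
  move=> _ [[s t] /= [s01 t01] <-]; rewrite !in_itv /= in s01 t01.
  by apply/rim/segment_ball => //; [have [] := pr t t01|have [] := qr t t01].
have := @arc_class_square _ _ _ gamma _ _ _ _ (const_curve u) q p (const_curve v) _ cH.
rewrite (@arc_class_cst _ _ _ gamma _ _ (const_curve u) u) //.
rewrite (@arc_class_cst _ _ _ gamma _ _ (const_curve v) v) // add0r addr0 => -> // t t01.
have h0 := zero_in01 R.
have h1 := one_in01 R.
have [ct _] := pr t t01; have [cqt _] := qr t t01.
have [cu _] := pr 0 h0; rewrite curve_src in cu.
have [cv _] := pr 1 h1; rewrite curve_tgt in cv.
split; rewrite /= /h /=.
- by rewrite !curve_src subrr scaler0 addr0 Kc ?inE.
- by rewrite scale1r addrC subrK Kc ?inE.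
- by rewrite scale0r addr0 Kc ?inE.
- by rewrite !curve_tgt subrr scaler0 addr0 Kc ?inE.
Qed.

Variables (N : H1 R S -> R) (hN : is_stable_norm A g N).
Hypothesis hgamma : exists L : R, forall x, (curve_length A g (gamma x) <= L%:E)%E.

(** An arc from u to v in a chart ball around x has the class of a segment from u
    to x followed by a segment from x to v. To bound the class of a segment s
    from u to x, complete it to gamma_u * s * beta with one rectifiable arc beta
    from x to b: the length of this loop is bounded, and the classes of gamma_u
    and beta drop out of the difference of the two segments. *)
Lemma small_cell (x : S) (W : set S) : nbhs x W -> exists B, [/\ nbhs x B, B `<=` W,
  (forall u v, B u -> B v -> exists p : curve R u v, forall t, 0 <= t <= 1 -> B (p t)) &
  exists C, forall u v (p : curve R u v), (forall t, 0 <= t <= 1 -> B (p t)) ->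
    N (arc_class gamma p) <= C].
Proof.
move=> nW; have [c [r [K [Ac cx r0 K0 [rim seg]]]]] := chart_cell hA hg nW.
have [/(_ c Ac) chc _ _] := hA; have [_ _ _ _ Kc] := chc.
pose B := [set y | chart_dom c y /\ `|chart_fun c x - chart_fun c y| < r].
have imc y : `|chart_fun c x - y| < r -> chart_im c y by move=> /rim[].
have arcB u v : B u -> B v -> exists p : curve R u v,
    (forall t, 0 <= t <= 1 -> B (p t)) /\
    (curve_length A g p <= (K * `|chart_fun c v - chart_fun c u|)%:E)%E.
  move=> [cu ur] [cv vr]; have [s [st sL]] := cell_segment chc imc seg ur vr.
  move: s st sL; rewrite !Kc ?inE // => s st sL; exists s; split=> // t t01.
  have tr := segment_ball t01 ur vr.
  by rewrite st /B /=; have [? ->] := chart_invK chc (imc _ tr).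
have Bx : B x by rewrite /B /= subrr normr0.
exists B; split.
- exact: nbhs_chart_cell.
- by move=> y [cy /rim[_]]; rewrite Kc ?inE.
- by move=> u v Bu Bv; have [p [pB _]] := arcB u v Bu Bv; exists p.
have [L hL] := hgamma; have [L' [beta hbeta]] := rectifiable_arc x.
have star u (s : curve R u x) : B u ->
    (curve_length A g s <= (K * `|chart_fun c x - chart_fun c u|)%:E)%E ->
    N (loop_class (gamma b) + arc_class gamma s + arc_class gamma beta) <= L + K * r + L'.
  move=> [cu ur] sL.
  rewrite -(arc_class_gamma gamma u) -!arc_class_cat arc_class_loop.
  apply: (stable_norm_loop gamma cS hA hg hN).
  apply: curve_length_cat => //; apply: curve_length_cat => //.
  by apply: (le_trans sL); rewrite lee_fin ler_wpM2l // ltW.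
exists ((L + K * r + L') + (L + K * r + L')) => u v p pB.
have h0 := zero_in01 R.
have h1 := one_in01 R.
have Bu : B u by rewrite -(curve_src p); exact: pB.
have Bv : B v by rewrite -(curve_tgt p); exact: pB.
have [su [suB suL]] := arcB u x Bu Bx; have [sv [svB svL]] := arcB v x Bv Bx.
have e : arc_class gamma p + arc_class gamma sv = arc_class gamma su.
  rewrite -arc_class_cat; apply: (arc_class_cell chc imc) => // t t01.
  rewrite /= /cat_fun; case: ifP => [t2|/negbT]; first by apply: pB; lra.
  by rewrite -ltNge => t2; apply: svB; lra.
have -> : arc_class gamma p =
    loop_class (gamma b) + arc_class gamma su + arc_class gamma beta -
    (loop_class (gamma b) + arc_class gamma sv + arc_class gamma beta).
  by rewrite -e [loop_class _ + (_ + _)]addrCA -[X in X - _]addrA addrK.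
by apply: (le_trans (stable_normB hN _ _)); apply: lerD; apply: star.
Qed.

Hypothesis kS : compact [set: S].

(** By compactness (a Lebesgue number) the arcs that a family of paths describes
    in a short enough time lie in cells; a fixed number of them covers [0, 1]. *)
Lemma homotopy_bounded (X : topologicalType) (F : R -> X -> S)
    (cF : forall x, {within `[0, 1], continuous (F^~ x)}) :
  compact [set: X] ->
  {within `[0, 1] `*` [set: X], continuous (fun tx : R * X => F tx.1 tx.2)} ->
  exists C, forall x T (T01 : 0 <= T <= 1),
    N [arc subarc (cF x) (zero_in01 R) T01] <= C.
Proof.
move=> kX /subspace_continuousP cFX.
(* One constant serves both as the bound and as the inverse of the duration. *)
pose Q C (tx : R * X) := forall (t01 : 0 <= tx.1 <= 1) s (s01 : 0 <= s <= 1),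
  `|tx.1 - s| * C < 1 -> N [arc subarc (cF tx.2) t01 s01] <= C.
have [|C C' [t x] CC' QC t01 s s01 sC|[t0 x0] [t01 _]|C hC] :=
    @compact_bounded R (R * X)%type (`[0, 1] `*` [set: X]) Q.
- by apply: compact_setX => //; exact: segment_compact.
- apply: le_trans (CC'); apply: QC; apply: le_lt_trans sC.
  by rewrite ler_wpM2l.
- have [B [nB _ _ [C hC]]] := small_cell (@filterT _ (nbhs (F t0 x0)) _).
  have := cFX (t0, x0) (conj t01 I) _ nB; rewrite nbhs_simpl /=.
  move=> [[V Y] /= [/nbhs_normP[e /= e0 eV] nY] VYB].
  exists (Num.max C (2 / e)); have e2 : 0 < e / 2 by lra.
  exists ([set t | `|t0 - t| < e / 2], Y).
    by split=> //=; exact: (nbhs_ball_norm t0 (PosNum e2)).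
  move=> [t x] /= [te Yx] t_01 s s01 /= se.
  apply: (@le_trans _ _ C); last by rewrite le_max lexx.
  apply: hC => u u01.
  have tse : `|t - s| < e / 2.
    rewrite -[_ < _](@ltr_pM2r _ (2 / e)) ?divr_gt0 // mulf_div [e * 2]mulrC.
    rewrite divff ?mulf_neq0 ?gt_eqF //.
    apply: le_lt_trans se; by rewrite ler_wpM2l // le_max lexx orbT.
  apply: (VYB (t + u * (s - t), x)); last first.
    have {}t_01 : 0 <= t <= 1 := t_01.
    by split=> //=; rewrite in_itv; exact: itv01_segment.
  split=> //; apply: eV => /=.
  have -> : t0 - (t + u * (s - t)) = (t0 - t) + u * (t - s) by lra.
  apply: (le_lt_trans (ler_normD _ _)); rewrite normrM.
  have : `|u| * `|t - s| <= `|t - s| by rewrite ler_piMl // ger0_norm; lra.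
  lra.
have [n Cn n0] : exists2 n : nat, C < n%:R & 0 < n%:R :> R.
  exists (Num.truncn `|C|).+1; last by rewrite ltr0n.
  by apply: le_lt_trans (truncnS_gt _); exact: ler_norm.
have step k x T (T01 : 0 <= T <= 1) : T <= k%:R / n%:R ->
    N [arc subarc (cF x) (zero_in01 R) T01] <= k%:R * C.
  elim: k T T01 => [|k IH] T T01 Tk.
    rewrite mul0r in Tk; have T0 : T = 0 by lra.
    rewrite (@arc_class_cst _ _ _ gamma _ _ _ (F 0 x)) ?(stable_norm0 hN) ?mul0r // => t _ /=.
    by rewrite T0 subrr mulr0 addr0.
  pose T' := Num.max 0 (T - n%:R^-1).
  have n1 : 0 < n%:R^-1 :> R by rewrite invr_gt0.
  rewrite mulrS mulrDl mul1r in Tk.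
  have [T'01 T'k TT'] : [/\ 0 <= T' <= 1, T' <= k%:R / n%:R & `|T' - T| <= n%:R^-1].
    have : 0 <= k%:R / n%:R :> R by rewrite divr_ge0.
    rewrite distrC /T' /Num.max; case: ifP => h ?; split; try lra; rewrite ger0_norm; lra.
  rewrite (arc_class_subarc gamma (cF x) (zero_in01 R) T'01 T01).
  apply: (le_trans (stable_normD hN _ _)); rewrite mulrS mulrDl mul1r addrC lerD //; last exact: IH.
  apply: (hC (T', x)) => //=.
  have [C0|C0] := leP C 0; first by apply: le_lt_trans ltr01; rewrite mulr_ge0_le0.
  apply: (@le_lt_trans _ _ (n%:R^-1 * C)); first by rewrite ler_wpM2r // ltW.
  by rewrite mulrC ltr_pdivrMr // mul1r.
exists (n%:R * C) => x T T01; apply: step.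
by rewrite divff ?gt_eqF //; lra.
Qed.

Lemma prefix_bounded x y (p : curve R x y) :
  exists C, forall T (T01 : 0 <= T <= 1),
    N [arc subarc (curve_cont p) (zero_in01 R) T01] <= C.
Proof.
have [|C hC] := @homotopy_bounded S (fun t _ => p t)
   (fun=> curve_cont p) kS; last by exists C; exact: hC b.
apply: (@within_comp _ _ _ _ _ (fun tx : R * S => tx.1) p _ _ (curve_cont p)).
  by apply: continuous_subspaceT; exact: continuous_fst.
by move=> _ [[t z] /= [t01 _] <-].
Qed.

(** In V the class of an arc depends on its endpoints only, since loops in V have
    class 0. Near a pair of points of K one arc of V therefore bounds all the
    others, up to short arcs in cells around the two points. *)
Lemma inessential_bounded (V K : set S) : @inessential_open R S V -> compact K -> K `<=` V ->
  exists C, forall u v (p : curve R u v), K u -> K v ->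
    (forall t, 0 <= t <= 1 -> V (p t)) -> N [arc p] <= C.
Proof.
move=> [oV nullV] cK KV.
pose Q (C : R) (uv : S * S) := forall p : curve R uv.1 uv.2,
  (forall t, 0 <= t <= 1 -> V (p t)) -> N [arc p] <= C.
have [||[u0 v0] [/= Ku Kv]|C hC] := @compact_bounded R (S * S)%type (K `*` K) Q.
- exact: compact_setX.
- by move=> C C' uv CC' QC p pV; apply: le_trans (CC'); exact: QC.
- have [B [nB BV arcB [C hC]]] := small_cell (open_nbhs_nbhs (conj oV (KV _ Ku)) : nbhs u0 V).
  have [B' [nB' BV' arcB' [C' hC']]] := small_cell (open_nbhs_nbhs (conj oV (KV _ Kv)) : nbhs v0 V).
  have [[u [v [q [Bu B'v qV]]]]|no] := pselect (exists u v (q : curve R u v),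
      [/\ B u, B' v & forall t, 0 <= t <= 1 -> V (q t)]); last first.
    exists 0; exists (B, B') => // -[u v] /= [Bu B'v] p pV; exfalso.
    by apply: no; exists u, v, p.
  exists (C + N [arc q] + C'); exists (B, B') => // -[u' v'] /= [Bu' B'v'] p pV.
  have [s sB] := arcB _ _ Bu' Bu; have [s' sB'] := arcB' _ _ B'v B'v'.
  have e : [arc p] = [arc s] + [arc q] + [arc s'].
    apply/eqP; rewrite -!arc_class_cat -subr_eq0 -arc_class_rev -arc_class_cat; apply/eqP.
    apply/arc_class_null/nullV => t t01.
    rewrite /= /cat_fun; case: ifP => [t2|/negbT]; first by apply: pV; lra.
    rewrite -ltNge /rev_fun /= /cat_fun => t2.
    case: ifP => [t3|/negbT]; last by rewrite -ltNge => t3; apply/BV'/sB'; lra.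
    case: ifP => [t4|/negbT]; last by rewrite -ltNge => t4; apply: qV; lra.
    by apply/BV/sB; lra.
  rewrite e; apply: (le_trans (stable_normD hN _ _)); rewrite lerD ?hC' //.
  by apply: (le_trans (stable_normD hN _ _)); rewrite lerD ?hC.
by exists C => u v p Ku Kv; apply: (hC (u, v)).
Qed.

(** Go from w to a nearby reference point w0 inside a cell, then to b along the
    reverse of gamma_w0, then around l. An open set that contains all this path
    contains l, which is not homotopic to a point, so it is not inessential. *)
Lemma escape_path (l : curve R b b) : loop_class l <> 0 ->
  exists C, forall w, exists c (q : curve R w c),
    (forall T (T01 : 0 <= T <= 1), N [arc subarc (curve_cont q) (zero_in01 R) T01] <= C) /\
    forall V : set S, @inessential_open R S V -> exists2 t, 0 <= t <= 1 & ~ V (q t).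
Proof.
move=> l0.
pose Q C w := exists c (q : curve R w c),
    (forall T (T01 : 0 <= T <= 1), N [arc subarc (curve_cont q) (zero_in01 R) T01] <= C) /\
    forall V : set S, @inessential_open R S V -> exists2 t, 0 <= t <= 1 & ~ V (q t).
have [|C C' w CC' [c [q [qC qV]]]|w0 _|C hC] := @compact_bounded R S setT Q => //.
- by exists c, q; split=> // T T01; apply: le_trans (CC').
- have [B [nB _ arcB [C1 hC1]]] := small_cell (@filterT _ (nbhs w0) _).
  pose P := cat_curve (rev_curve (gamma w0)) l.
  have [C2 hC2] := prefix_bounded P.
  have C20 : 0 <= C2 by apply: le_trans (hC2 0 (zero_in01 R)); exact: (stable_norm_ge0 hN).
  exists (C1 + C2); apply: filterS (nB) => w Bw.
  have [s sB] := arcB w w0 Bw (nbhs_singleton nB).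
  exists b, (cat_curve s P); split=> [T T01|V [_ nullV]].
    have pre U (U01 : 0 <= U <= 1) : U <= 2^-1 ->
        N [arc subarc (curve_cont (cat_curve s P)) (zero_in01 R) U01] <= C1.
      move=> U2; apply: hC1 => t t01; rewrite /= add0r subr0 /cat_fun.
      by rewrite ifT; [apply: sB|]; nra.
    have [T2|T2] := leP T 2^-1; first by apply: (le_trans (pre T T01 T2)); rewrite lerDl.
    have h01 : 0 <= (2^-1 : R) <= 1 by lra.
    rewrite (arc_class_subarc gamma _ (zero_in01 R) h01 T01).
    apply: (le_trans (stable_normD hN _ _)); rewrite lerD ?pre //.
    have T01' : 0 <= 2 * T - 1 <= 1 by lra.
    rewrite (_ : [arc _] = [arc subarc (curve_cont P) (zero_in01 R) T01']) ?hC2 //.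
    apply: arc_class_eq => t t01; rewrite /= add0r subr0 {1}/cat_fun.
    have -> : 2 * (2^-1 + t * (T - 2^-1)) = 1 + t * (2 * T - 1) by lra.
    case: ifP => h; last by rewrite addrAC subrr add0r.
    have t0 : t = 0 by nra.
    by rewrite t0 !mul0r addr0 -[RHS]/(P 0) curve_tgt curve_src.
  apply: contrapT => noexit; apply: l0.
  have {}noexit t : 0 <= t <= 1 -> V (cat_curve s P t).
    by move=> t01; apply: contrapT => nV; apply: noexit; exists t.
  rewrite -(arc_class_loop gamma); apply/arc_class_null/nullV => t t01.
  (* l occupies the last quarter of the path. The parameter 3/4 belongs to the
     preceding piece, and l 0 = l 1 makes up for it. *)
  have lV t' : 0 < t' <= 1 -> V (l t').
    move=> t'01; have /noexit : 0 <= (3 + t') / 4 <= 1 by lra.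
    rewrite /= /cat_fun ifF; last by apply/negbTE; rewrite -ltNge; lra.
    rewrite /= /cat_fun ifF; last by apply/negbTE; rewrite -ltNge; lra.
    by congr (V (l _)); lra.
  have [->|t0] := eqVneq t 0; last by apply: lV; rewrite lt_neqAle eq_sym t0; lra.
  by rewrite curve_src -(curve_tgt l); apply: lV; rewrite ltr01 lexx.
by exists C => w; exact: hC.
Qed.

(** * Displacements *)

Variables (f : S -> S) (F : isotopy_from_id (R := R) f).

Local Notation Phi := (displacement F gamma).

Lemma displacement_arc n x : Phi n x = [arc iter_trace F n x].
Proof.
rewrite /displacement -(arc_class_loop gamma) !arc_class_cat arc_class_rev !arc_class_gamma.
by rewrite addrAC subrr add0r.
Qed.

Lemma displacement_sum n x : Phi n x = \sum_(i < n) [arc trace F (iter i f x)].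
Proof.
rewrite displacement_arc; elim: n => [|n IH].
  by rewrite big_ord0 (@arc_class_cst _ _ _ gamma _ _ (const_curve x) x).
by rewrite big_ord_recr /= -IH arc_class_cat.
Qed.

Lemma displacementS n x : Phi n.+1 x = Phi n x + [arc trace F (iter n f x)].
Proof. by rewrite !displacement_sum big_ord_recr. Qed.

Lemma displacementD m n x : Phi (m + n) x = Phi m x + Phi n (iter m f x).
Proof.
rewrite !displacement_sum big_split_ord /=; congr (_ + _); apply: eq_bigr => i _ /=.
by rewrite addnC iterD.
Qed.

(** The square (s, t) |-> F_t(p(s)). *)
Lemma trace_push x y (p : curve R x y) (q : curve R (f x) (f y)) :
  (forall t, 0 <= t <= 1 -> q t = f (p t)) ->
  [arc p] + [arc trace F y] = [arc trace F x] + [arc q].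
Proof.
move=> qp.
pose h (st : R * R) := (st.2, p st.1).
have ch : {within `[0, 1] `*` `[0, 1], continuous h}.
  have c1 : {within `[0, 1] `*` `[0, 1], continuous (fun st : R * R => p st.1)}.
    apply: (@within_comp _ _ _ _ _ (fun st : R * R => st.1) p _ _ (curve_cont p)).
      by apply: continuous_subspaceT; exact: continuous_fst.
    by move=> _ [[s t] /= [s01 _] <-].
  have c2 : {within `[0, 1] `*` `[0, 1], continuous (fun st : R * R => st.2)}.
    by apply: continuous_subspaceT; exact: continuous_snd.
  exact: (continuous_pair c2 c1).
have cH := within_comp ch _ (@isotopy_cont R S f F).
apply: (arc_class_square gamma (cH _)).
  by move=> _ [[s t] /= [_ t01] <-].
by move=> t t01; rewrite /= isotopy0 isotopy1 curve_src curve_tgt qp.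
Qed.

(** The basic comparison: p followed by the trace of y is homotopic to the trace
    of x followed by the image of p under f^n. *)
Lemma displacement_push n x y (p : curve R x y) (q : curve R (iter n f x) (iter n f y)) :
  homeomorphism f -> (forall t, 0 <= t <= 1 -> q t = iter n f (p t)) ->
  [arc p] + Phi n y = Phi n x + [arc q].
Proof.
move=> hf; elim: n q => [|n IH] q qp.
  rewrite !displacement_sum !big_ord0 addr0 add0r; apply: arc_class_eq => t t01.
  by rewrite qp.
have [cn _] := homeomorphism_iter n hf.
have cq' : {within `[0, 1], continuous (iter n f \o p)}.
  apply: (@within_comp _ _ _ _ setT p (iter n f)); first exact: curve_cont.
    by [].
  exact: continuous_subspaceT.
have q0 : (iter n f \o p) 0 = iter n f x by rewrite /= curve_src.
have q1 : (iter n f \o p) 1 = iter n f y by rewrite /= curve_tgt.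
have := IH (Curve cq' q0 q1) (fun _ _ => erefl).
rewrite !displacementS addrA => ->.
rewrite -!addrA; congr (_ + _); exact: trace_push.
Qed.

Lemma displacement_bounded : exists C, forall n x, N (Phi n x) <= n%:R * C.
Proof.
have [C hC] := homotopy_bounded (@trace_cont R S f F) kS (@isotopy_cont R S f F).
exists C => n x; elim: n => [|n IH].
  by rewrite displacement_sum big_ord0 (stable_norm0 hN) mul0r.
rewrite displacementS -natr1 mulrDl mul1r.
apply: (le_trans (stable_normD hN _ _)); apply: lerD => //.
rewrite (_ : [arc _] = [arc subarc (@trace_cont R S f F (iter n f x)) (zero_in01 R) (one_in01 R)]) //.
by apply: arc_class_eq => t _; rewrite /= add0r subr0 mulr1.
Qed.

(** Both sides of Phi^(n+j)(x) = Phi^(j+n)(x) are expanded: a shift in time by j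
    trades Phi^n for Phi^j, which is bounded independently of n. *)
Lemma displacement_shift j : exists C, forall n x, N (Phi n (iter j f x) - Phi n x) <= C.
Proof.
have [C hC] := displacement_bounded; exists (j%:R * C + j%:R * C) => n x.
have -> : Phi n (iter j f x) - Phi n x = Phi j (iter n f x) - Phi j x.
  have : Phi (j + n) x = Phi (n + j) x by rewrite addnC.
  rewrite !displacementD => e.
  by apply/eqP; rewrite subr_eq addrAC eq_sym subr_eq addrC -e addrC.
by apply: (le_trans (stable_normB hN _ _)); apply: lerD.
Qed.

Lemma open_iterz_image k (W : set S) : homeomorphism f -> open W -> open (iterz_image f k W).
Proof.
move=> hf oW; case: k => n /=.
  have [_ [h [fK hK ch]]] := homeomorphism_iter n hf.
  rewrite (_ : _ @` W = h @^-1` W); first by move/continuousP: ch; apply.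
  by apply/seteqP; split=> [_ [y Wy <-]|y Wy]; [rewrite /= fK|exists (h y); rewrite ?hK].
have [cn _] := homeomorphism_iter n.+1 hf.
by move/continuousP: cn; apply.
Qed.

(** By compactness finitely many images of U cover K, so that the time shifts are
    bounded. *)
Lemma saturation_bounded (U K : set S) : homeomorphism f -> open U -> compact K ->
  K `<=` \bigcup_(k in [set: int]) iterz_image f k U ->
  exists C, forall x, K x -> exists2 u, U u & forall n, N (Phi n x - Phi n u) <= C.
Proof.
move=> hf oU kK KU.
apply: (compact_bounded (Q := fun C x => exists2 u, U u & forall n, N (Phi n x - Phi n u) <= C)) => //.
  by move=> C C' x CC' [u Uu uC]; exists u => // n; apply: le_trans (CC').
move=> x /KU[k _ xk].
have nk : nbhs x (iterz_image f k U) by apply: open_nbhs_nbhs; split=> //; exact: open_iterz_image.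
case: k {xk} nk => j nj; [have [C hC] := displacement_shift j|have [C hC] := displacement_shift j.+1];
  exists C; apply: filterS (nj) => y /=.
  by move=> [u Uu <-]; exists u.
move=> Uy; exists (iter j.+1 f y) => // n.
by rewrite -(stable_normN hN) opprB; exact: hC.
Qed.

(** The arc q from f^n(x) escapes from every inessential open set, in particular
    from f^n(V), so it leaves f^n(K), and y is the point at which its image under
    f^-n leaves K for the first time. *)
Lemma displacement_escape (V K : set S) :
  homeomorphism f -> @inessential_open R S V -> open K -> closure K `<=` V ->
  (exists l : curve R b b, loop_class l <> 0) ->
  exists C, forall n x, K x -> exists2 y, ~ K y & N (Phi n x - Phi n y) <= C.
Proof.
move=> hf eV oK KV [l l0].
have kK : compact (closure K) by apply: (subclosed_compact _ kS) => //; exact: closed_closure.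
have [C1 hC1] := inessential_bounded eV kK KV.
have [C2 hC2] := escape_path l0.
exists (C1 + C2) => n x Kx.
have [c [q [qC qexit]]] := hC2 (iter n f x).
have [cn [h [fK hK ch]]] := homeomorphism_iter n hf.
have [t t01 nVt] := qexit _ (inessential_open_preimage cn ch hK eV).
have cG : {within `[0, 1], continuous (h \o q)}.
  apply: (@within_comp _ _ _ _ setT q h); first exact: curve_cont.
    by [].
  exact: continuous_subspaceT.
have G0 : (h \o q) 0 = x by rewrite /= curve_src fK.
have [||T T01 [nKT clT bef]] := first_exit cG oK; first by rewrite G0.
  by exists t => // Kt; apply: nVt; apply/KV/subset_closure.
exists ((h \o q) T) => //.
have inV s : 0 <= s <= T -> V ((h \o q) s).
  move=> sT; apply: KV; have [->//|sT'] := eqVneq s T.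
  by apply/subset_closure/bef; rewrite [s < T]lt_neqAle sT'; lra.
have p0 := subarc_src (h \o q) 0 T; have p1 := subarc_tgt (h \o q) 0 T.
rewrite G0 in p0; pose p := Curve (subarc_cont cG (zero_in01 R) T01) p0 p1.
have q0 := subarc_src q 0 T; have q1 := subarc_tgt q 0 T.
rewrite curve_src in q0; rewrite -[q T]hK in q1.
pose q' := Curve (subarc_cont (curve_cont q) (zero_in01 R) T01) q0 q1.
have e : [arc p] + Phi n ((h \o q) T) = Phi n x + [arc q'].
  by apply: displacement_push => // s _; rewrite /= hK.
have -> : Phi n x - Phi n ((h \o q) T) = [arc p] - [arc q'].
  by apply/eqP; rewrite subr_eq addrAC eq_sym subr_eq e.
apply: (le_trans (stable_normB hN _ _)); apply: lerD.
  apply: hC1 => //.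
    by apply: subset_closure.
  by move=> s s01; apply: inV; rewrite /= add0r subr0; nra.
by rewrite (@arc_class_eq _ _ _ gamma _ _ _ _ q' (subarc (curve_cont q) (zero_in01 R) T01)) ?qC.
Qed.

Lemma displacement_near_essential (z : S) (U : set S) :
  homeomorphism f -> hausdorff_space S -> essential_points R f z -> nbhs z U ->
  exists C, forall n x, exists2 u, U u & N (Phi n x - Phi n u) <= C.
Proof.
move=> hf haus hz hU.
have [loops|noloop] := pselect (exists l : curve R b b, loop_class l <> 0); last first.
  have Phi0 n x : Phi n x = 0.
    by apply: contrapT => Pn; apply: noloop; eexists; exact: Pn.
  by exists 0 => n x; exists z; [exact: nbhs_singleton|rewrite !Phi0 subr0 (stable_norm0 hN)].
have nU : nbhs z U° by exact: nbhs_interior.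
have [V [eV UV]] := hz _ nU.
set O := \bigcup_(k in _) _ in UV.
have oO : open O by apply: bigcup_open => k _; apply: open_iterz_image => //; exact: open_interior.
have cO : closed (~` O) by exact: open_closedC.
have cV : closed (~` V) by apply: open_closedC; case: eV.
have OV0 : ~` O `&` ~` V = set0 by apply/seteqP; split=> // x [/UV].
have [V' [W [oV' oW OV' VW V'W]]] :=
  (@normal_openP R S).1 (compact_normal haus kS) _ _ cO cV OV0.
have clV' : closure V' `<=` V.
  move=> x clx; apply: contrapT => /VW Wx.
  by have [y [V'y Wy]] := clx W (open_nbhs_nbhs (conj oW Wx)); have : set0 y by rewrite -V'W.
have [C1 hC1] := displacement_escape hf eV oV' clV' loops.
have [||C2 hC2] := @saturation_bounded U° (~` V') hf (@open_interior _ U).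
- by apply: (subclosed_compact _ kS) => //; exact: open_closedC.
- by move=> x nV'x; apply: contrapT => nOx; apply/nV'x/OV'.
(* The maximum covers the points outside V', for which y = x. *)
have C10 : 0 <= Num.max 0 C1 by rewrite le_max lexx.
exists (Num.max 0 C1 + C2) => n x.
have [y V'y xy] : exists2 y, ~ V' y & N (Phi n x - Phi n y) <= Num.max 0 C1.
  have [V'x|nV'x] := pselect (V' x); last first.
    by exists x; rewrite // subrr (stable_norm0 hN).
  have [y nV'y xy] := hC1 n x V'x; exists y => //.
  by rewrite le_max xy orbT.
have [u Uu yu] := hC2 y V'y; exists u; first exact: interior_subset Uu.
rewrite -[Phi n x](subrK (Phi n y)) -addrA.
by apply: (le_trans (stable_normD hN _ _)); apply: lerD.
Qed.

End Displacement.

Theorem lemma6p6 (R : realType) (S : topologicalType)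
  (A : set (chart R S)) (g : chart R S -> 'rV[R]_2 -> 'M[R]_2)
  (hS : closed_connected_space S) (hO : orientable_surface R S)
  (hH : hyperbolic_surface R S)
  (hA : smooth_atlas A) (hg : riemannian_metric A g)
  (N : H1 R S -> R) (hN : is_stable_norm A g N)
  (f : S -> S) (hf : homeomorphism f) (F : isotopy_from_id (R := R) f)
  (b : S) (gamma : forall x, curve R b x)
  (hgamma : exists L : R, forall x, (curve_length A g (gamma x) <= L%:E)%E)
  (z : S) (hz : essential_points R f z) (U : set S) (hU : nbhs z U) :
  (exists2 r : R, 0 < r & forall n : nat,
     [set displacement F gamma n x | x in [set: S]] `<=`
     norm_nbhd N r [set displacement F gamma n y | y in U]) /\
  rotation_set F gamma N U = rotation_set F gamma N [set: S].
Proof.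
have [kS haus cS] := hS.
have [C hC] := displacement_near_essential cS hA hg hN hgamma kS F hf haus hz hU.
have C0 : 0 <= C.
  by have [u _] := hC 0%N b; apply: le_trans; exact: (stable_norm_ge0 hN).
split.
  exists (C + 1) => [|n _ [x _ <-]]; first lra.
  have [u Uu xu] := hC n x; exists (displacement F gamma n u); first by exists u.
  by rewrite /= -(stable_normN hN) opprB; lra.
apply/seteqP; split=> v [n_ [x_ [Ux n_oo xv]]]; first by exists n_, x_.
pose u_ k := sval (cid2 (hC (n_ k) (x_ k))).
exists n_, u_; split=> // [k|]; first by rewrite /u_; case: cid2.
have uC k : N (displacement F gamma (n_ k) (x_ k) - displacement F gamma (n_ k) (u_ k)) <= C.
  by rewrite /u_; case: cid2.
apply: (@squeeze_cvgr _ _ _ _ (cst 0)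
  (fun k => N ((n_ k)%:R^-1 *: displacement F gamma (n_ k) (x_ k) - v) + (n_ k)%:R^-1 * C)).
- near=> k; rewrite (stable_norm_ge0 hN) /=.
  set a := displacement _ _ _ (u_ k); set c := displacement _ _ _ (x_ k).
  have -> : (n_ k)%:R^-1 *: a - v = ((n_ k)%:R^-1 *: c - v) - (n_ k)%:R^-1 *: (c - a).
    by rewrite scalerBr opprB [RHS]addrC addrA subrK.
  apply: (le_trans (stable_normB hN _ _)); apply: lerD => //.
  by rewrite (stable_normZ hN) ger0_norm ?invr_ge0 // ler_wpM2l ?invr_ge0 //; exact: uC.
- exact: cvg_cst.
rewrite -[X in _ --> X]addr0 -[X in _ + X](mul0r C).
apply: cvgD => //; apply: cvgMl.
apply: (gtr0_cvgV0 _).2; last exact/cvgrnyP.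
near=> k; rewrite ltr0n; near: k.
exact: (cvgnyPgt _).1.
Unshelve. all: by end_near. Qed.
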